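(* Let $\omega\in\mathcal H$ with Hodge decomposition $\omega=\partial\eta+\Theta$, $\eta\in\mathcal F$, $\Theta\in\ker\partial^\ast$, and write $\Theta=\sum_{w}\Theta_{w}\partial^{(|w|+1)}\psi_{w}$. For any word $w$ define $$\omega\circ F_w:=\partial(\eta\circ F_w)+\sum_{w'}\Theta_{w'}\,\partial^{(|w'|-|w|+1)}(\psi_{w'}\circ F_w),$$ where $\partial^{(n)}=\partial$ for $n\le0$. Then $\omega\circ F_w\in\mathcal H$, with Hodge decomposition $$P_{\operatorname{Im}\partial}(\omega\circ F_w)=\partial\Big(\eta\circ F_w+\sum_{w':K_w\subsetneqq K_{w'}}\Theta_{w'}(\psi_{w'}\circ F_w)\Big),\qquad P_{\ker\partial^\ast}(\omega\circ F_w)=\sum_{\widetilde w}\Theta_{w\widetilde w}\,\partial^{(|\widetilde w|+1)}\psi_{\widetilde w},$$ where $P_{\operatorname{Im}\partial}$ and $P_{\ker\partial^\ast}$ are the orthogonal projections of $\mathcal H$ onto $\operatorname{Im}\partial$ and $\ker\partial^\ast$. Moreover, the energy measures satisfy $$(\nu_{\omega,\omega'})_{F_w^{-1}}=r^{-|w|}\,\nu_{\omega\circ F_w,\,\omega'\circ F_w}\quad\text{for all }\omega,\omega'\in\mathcal H,$$ where $(\nu_{\omega,\omega'})_{F_w^{-1}}(A)=\nu_{\omega,\omega'}(F_wA)$.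
   Context: Gasket. Let $r=3/5$, $q_0=(1/2,\sqrt3/2)$, $q_1=(0,0)$, $q_2=(1,0)$, $F_i(x)=\frac12(x-q_i)+q_i$, and let $K\subset\mathbb R^2$ be the Sierpinski gasket (attractor of $F_0,F_1,F_2$). For a word $w=w_1\cdots w_n$ over $\{0,1,2\}$ (length $|w|=n$, empty word allowed with $F_\emptyset=\mathrm{Id}$) put $F_w=F_{w_1}\circ\dots\circ F_{w_n}$, $K_w=F_w(K)$; indices are mod 3. $V_0=\{q_0,q_1,q_2\}$, $V_n=\bigcup_{|w|=n}F_w(V_0)$. Write $p\sim_nq$ if $p\ne q$ in $V_n$ lie in a common $K_w$, $|w|=n$. $\mathcal E(u,v)=\lim_m r^{-m}\sum_{p\sim_mq}(u(p)-u(q))(v(p)-v(q))$ (each edge once), $\mathcal F$ is the set of continuous $u:K\to\mathbb R$ for which these sums with $v=u$ are bounded in $m$, $\mathcal F_{V_0}=\{u\in\mathcal F: u|_{V_0}=0\}$. $h\in\mathcal F$ is harmonic if $\mathcal E(h,\varphi)=0$ for all $\varphi\in\mathcal F_{V_0}$. The energy measure $\nu_{u,v}$ is the unique finite signed Borel measure with $\nu_{u,v}(K_w)=r^{-|w|}\mathcal E(u\circ F_w,v\circ F_w)$ for all $w$. One-forms. $\mathcal H$ is the Hilbert space obtained from finite sums of symbols $f\partial u$ ($f\in C(K)$, $u\in\mathcal F$) by quotienting and completing with respect to the bilinear extension of $\langle f\partial u,g\partial v\rangle_{\mathcal H}=\int_Kfg\,d\nu_{u,v}$; bounded Borel functions act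 on $\mathcal H$ by multiplication; $\partial:\mathcal F\to\mathcal H$, $\partial u=1\,\partial u$. For $\omega,\omega'\in\mathcal H$, $\nu_{\omega,\omega'}$ is the finite signed measure with $\int\varphi\,d\nu_{\omega,\omega'}=\langle\varphi\omega,\omega'\rangle_{\mathcal H}$ for bounded Borel $\varphi$. $\ker\partial^\ast=\{\omega:\langle\omega,\partial u\rangle_{\mathcal H}=0\ \forall u\in\mathcal F\}$. Hodge decomposition: $\mathcal H=\operatorname{Im}\partial\oplus\ker\partial^\ast$ (orthogonal, both subspaces closed). Piecewise functions and loops. $P_n\mathcal F$ ($n\ge0$) is the set of families $u=\{u^{(w)}\}_{|w|=n}$, $u^{(w)}:K_w\to\mathbb R$ with $u^{(w)}\circ F_w\in\mathcal F$, and $\partial^{(n)}u=\sum_{|w|=n}\mathds 1_{K_w}\partial\tilde u^{(w)}\in\mathcal H$ with any extension $\tilde u^{(w)}\in\mathcal F$ of $u^{(w)}$ (independent of the extension); for $n\le0$, $P_n\mathcal F=\mathcal F$. For $u\in P_n\mathcal F$, $u\circ F_w\in P_{n-|w|}\mathcal F$ has representatives $u^{(w\widetilde w)}\circ F_w$, $|\widetilde w|=n-|w|$, if $n\ge|w|$, and is $u^{(w_1\cdots w_n)}\circ F_w\in\mathcal F$ if $n<|w|$. Let $\psi\in P_1\mathcal F$ have representatives $\psi^{(i)}$ on $K_i$ with $\psi^{(i)}\circ F_i$ harmonic, $\psi^{(i)}(q_i)=0$, $\psi^{(i)}(F_iq_{i+1})=1$, $\psi^{(i)}(F_iq_{i+2})=-1$.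 For a word $w$, $\psi_w\in P_{|w|+1}\mathcal F$ equals $\psi^{(i)}\circ F_w^{-1}$ on $K_{wi}$ and $0$ on all other cells of level $|w|+1$. The family $\{\partial^{(|w|+1)}\psi_w\}_w$ (over all words) is an orthogonal basis of $\ker\partial^\ast$ with $\|\partial^{(|w|+1)}\psi_w\|_{\mathcal H}^2=30\,(5/3)^{|w|}$, so every $\Theta\in\ker\partial^\ast$ has a unique expansion with coefficients $\Theta_w$. *)

(* Defs.v *)
From HB Require Import structures.
From mathcomp Require Export all_boot all_order all_algebra.
From mathcomp Require Export all_classical all_reals all_analysis.
From mathcomp.analysis.showcase Require Export summability.

Set Implicit Arguments.
Unset Strict Implicit.
Unset Printing Implicit Defensive.

Export Order.TTheory GRing.Theory Num.Theory.
Export numFieldNormedType.Exports.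

Global Open Scope classical_set_scope.
Global Open Scope ring_scope.

(* The product sigma-algebra carried by [R * R] is the Borel sigma-algebra of
   the plane.

   A function on a subset [A] of the plane (such as the gasket [K] or a cell
   [K_w]) is encoded by a function on the whole plane of which only the values
   on [A] matter.  A measure on [K] is encoded by a measure on the plane that
   is carried by [K]. *)
Notation plane R := (R * R)%type.

Notation word := (seq 'I_3).

Section Gasket.
Context {R : realType}.
Implicit Types (K : set (plane R)) (w : word) (u v : plane R -> R).

Definition rfac : R := 3 / 5.

Definition vtx (i : 'I_3) : plane R :=
  if i == 0 then (1 / 2, Num.sqrt 3 / 2)
  else if i == 1 then (0, 0) else (1, 0).

Definition F1 (i : 'I_3) (x : plane R) : plane R :=
  (1 / 2) *: (x - vtx i) + vtx i.

Definition F1inv (i : 'I_3) (x : plane R) : plane R :=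
  2 *: (x - vtx i) + vtx i.

Definition Fw w : plane R -> plane R := foldr (fun i g => F1 i \o g) id w.

Definition Fwinv w : plane R -> plane R := foldr (fun i g => g \o F1inv i) id w.

Definition attractor K : Prop :=
  [/\ K !=set0, compact K & K = \bigcup_(i in [set: 'I_3]) (F1 i @` K)].

Definition cell K w : set (plane R) := Fw w @` K.

Definition V (n : nat) : set (plane R) :=
  [set p | exists w i, size w = n /\ p = Fw w (vtx i)].

Definition adj K (n : nat) (p q : plane R) : Prop :=
  [/\ V n p, V n q, p <> q &
      exists w, [/\ size w = n, cell K w p & cell K w q]].

(* The sum runs over ordered pairs, so that each edge occurs twice; this is
   compensated by the factor 1 / 2. *)
Definition En K (n : nat) u v : R :=
  rfac ^- n * (1 / 2 * \sum_(e \in [set e | adj K n e.1 e.2])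
                         (u e.1 - u e.2) * (v e.1 - v e.2)).

Definition energy K u v : R := limn (fun m => En K m u v).

Definition dom K : set (plane R -> R) :=
  [set u | {within K, continuous u} /\
           exists M : R, forall m, En K m u u <= M].

Definition harmonic_fun K u : Prop :=
  dom K u /\
  forall v, dom K v -> (forall i, v (vtx i) = 0) -> energy K u v = 0.

Definition energy_measure K u v (nu : {charge set (plane R) -> \bar R}) : Prop :=
  (forall A, measurable A -> A `&` K = set0 -> nu A = 0%E) /\
  (forall w, nu (cell K w) =
     (rfac ^- size w * energy K (u \o Fw w) (v \o Fw w))%:E).

(* Integral with respect to a finite signed measure, through its Jordan
   decomposition (which does not depend on the chosen Hahn decomposition). *)
Definition cintegral (nu : {charge set (plane R) -> \bar R})
    (A : set (plane R)) (f : plane R -> R) : R :=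
  let P := cid (Hahn_decomposition nu) in
  let N := cid (projT2 P) in
  Rintegral (jordan_pos (projT2 N)) A f - Rintegral (jordan_neg (projT2 N)) A f.

Definition bounded_borel K (phi : plane R -> R) : Prop :=
  measurable_fun K phi /\ exists M : R, forall x, K x -> `|phi x| <= M.

(* An element of P_n F is a family indexed by words, of which only the members
   at words of length n matter; for n <= 0, where P_n F = F, the function is
   the member at the empty word. *)
Definition pw_dom K (n : nat) (u : word -> plane R -> R) : Prop :=
  forall w, size w = n -> dom K (u w \o Fw w).

Definition pw_comp (n : nat) (u : word -> plane R -> R) w :
    word -> plane R -> R :=
  fun v : word => if (size w <= n)%N then u (w ++ v) \o Fw w
           else u (take n w) \o Fw w.

Definition psi_spec K (psi : word -> plane R -> R) : Prop :=
  pw_dom K 1 psi /\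
  forall i : 'I_3,
    [/\ harmonic_fun K (psi [:: i] \o F1 i),
        psi [:: i] (vtx i) = 0,
        psi [:: i] (F1 i (vtx (i + 1))) = 1 &
        psi [:: i] (F1 i (vtx (i + 2))) = -1].

(* Only the members at words v of length |w| + 1 matter, and for these
   [prefix w v] means that v = w i with [drop (size w) v = [:: i]]. *)
Definition psi_at (psi : word -> plane R -> R) w : word -> plane R -> R :=
  fun v : word => if prefix w v then psi (drop (size w) v) \o Fwinv w else cst 0.

End Gasket.

(* The Hilbert space of one-forms is determined, up to a unique isometry
   compatible with the symbols, as the completion of the space of finite sums
   of symbols: [symb f u] is the class of the symbol f du. *)
Section OneForms.
Context {R : realType} {H : completeNormedModType R}.
Variables (K : set (plane R)) (dot : {dot H for idfun})
  (symb : (plane R -> R) -> (plane R -> R) -> H)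
  (act : (plane R -> R) -> H -> H).
Implicit Types (u v f g : plane R -> R) (om : H) (S : set H) (w : word).

Record one_form_space
    (nu : (plane R -> R) -> (plane R -> R) ->
          {charge set (plane R) -> \bar R}) : Prop := {
  dot_norm : forall om, dot om om = `|om| ^+ 2 ;
  dot_sym : forall f g u v,
    {within K, continuous f} -> {within K, continuous g} ->
    dom K u -> dom K v ->
    dot (symb f u) (symb g v) = cintegral (nu u v) K (f \* g) ;
  sym_dense : closure
    [set om | exists2 s : seq ((plane R -> R) * (plane R -> R)),
       (forall p, p \in s -> {within K, continuous p.1} /\ dom K p.2) &
       om = \sum_(p <- s) symb p.1 p.2] = setT }.

(* Multiplication by a bounded Borel function: the bounded operator given on
   the dense subspace of symbols by phi (f du) = (phi f) du. *)
Record borel_action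
    (nu : (plane R -> R) -> (plane R -> R) ->
          {charge set (plane R) -> \bar R}) : Prop := {
  act_linear : forall phi, bounded_borel K phi -> linear (act phi) ;
  act_continuous : forall phi, bounded_borel K phi -> continuous (act phi) ;
  act_sym : forall phi f g u v, bounded_borel K phi ->
    {within K, continuous f} -> {within K, continuous g} ->
    dom K u -> dom K v ->
    dot (act phi (symb f u)) (symb g v) = cintegral (nu u v) K (phi \* f \* g) }.

Definition form_measure om om' (mu : {charge set (plane R) -> \bar R}) : Prop :=
  (forall A, measurable A -> A `&` K = set0 -> mu A = 0%E) /\
  (forall phi, bounded_borel K phi -> cintegral mu K phi = dot (act phi om) om').

Definition partial u : H := symb (cst 1) u.

Definition im_partial : set H := partial @` dom K.

Definition ker_dstar : set H :=
  [set om | forall u, dom K u -> dot om (partial u) = 0].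

Definition orth_proj S om om' : Prop :=
  S om' /\ forall z, S z -> dot (om - om') z = 0.

Definition extension (A : set (plane R)) u : plane R -> R :=
  xget (cst 0) [set v | dom K v /\ {in A, v =1 u}].

Definition pw_d (n : int) (u : word -> plane R -> R) : H :=
  match n with
  | Posz m.+1 => \sum_(w : m.+1.-tuple 'I_3)
                   act \1_(cell K w) (partial (extension (cell K w) (u w)))
  | _ => partial (u [::])
  end.

(* Unconditional summation over the countable set of all words. *)
Definition has_sum (x : word -> H) om : Prop := partial_sum x @ totally --> om.

Definition summable_in (x : word -> H) : Prop := cvg (partial_sum x @ totally).

Definition sum_in (x : word -> H) : H := lim (partial_sum x @ totally).

Section Hodge.
Variable psi : word -> plane R -> R.

Definition d_psi w : H := pw_d ((size w)%:Z + 1) (psi_at psi w).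

Definition psi_comp w' w : word -> plane R -> R :=
  pw_comp (size w').+1 (psi_at psi w') w.

Record hodge om (eta : plane R -> R) (Theta : H) (c : word -> R) : Prop := {
  hodge_dom : dom K eta ;
  hodge_ker : ker_dstar Theta ;
  hodge_decomp : om = partial eta + Theta ;
  hodge_sum : has_sum (fun w => c w *: d_psi w) Theta }.

Definition form_comp_term (c : word -> R) w w' : H :=
  c w' *: pw_d ((size w')%:Z - (size w)%:Z + 1) (psi_comp w' w).

Definition form_comp (eta : plane R -> R) (c : word -> R) w : H :=
  partial (eta \o Fw w) + sum_in (form_comp_term c w).

(* For K_w strictly contained in K_{w'} one has |w'| + 1 <= |w|, so that
   psi_{w'} o F_w belongs to F and is the member of [psi_comp w' w] at the
   empty word. *)
Definition exact_part (eta : plane R -> R) (c : word -> R) w : plane R -> R :=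
  fun x => eta (Fw w x) +
    \sum_(w' \in [set w' | cell K w `<` cell K w'])
      c w' * psi_comp w' w [::] x.

End Hodge.
End OneForms.

(* Main.v *)
(** The pull-back by [Fw w] scales inner products by [r^|w|] on everything
    supported in the cell [K_w].  On the dense part of the one-forms this is
    self-similarity of the energy: write [piece b g] for the form supported in
    [K_b] that is [d(g o F_b^{-1})] there.  Pieces on different cells of one
    level are orthogonal, [<piece b g, piece b g'> = r^{-|b|} E(g, g')], and
    each piece is the sum of its pieces on the subcells.  Both [d eta] and
    [d psi_a] are sums of pieces on all sufficiently fine levels, and the
    pieces of their pull-backs by [Fw w] are exactly their pieces inside [K_w].
    Hence pulling back contracts the norm, which gives summability of the
    pulled-back series, and the scaling identity for
    [<1_{K_wv} om, om'>] passes to the limit; as cells generate the Borel sets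
    of [K], the energy measures scale.  The terms of the pulled-back series
    vanish off the words comparable with [w]; strict prefixes of [w] give exact
    forms, and words [w v] give [d psi_v], which is orthogonal to exact forms by
    Kirchhoff's law.

    Three points need care.  Junction points carry no energy: their masses are
    nonnegative and inclusion-exclusion makes them add up to [0].  The
    operator of multiplication by the indicator of a cell is a weak limit of
    multiplications by continuous functions, whence it is a self-adjoint
    projection.  Weak harmonicity of the pieces of [psi] is turned into
    [E(h, v) = E_0(h, v)] by testing against splines built from these pieces
    themselves, so that no harmonic function has to be constructed. *)
Require Import Defs.
From mathcomp Require Import ring lra zify measurable_realfun finmap classical_sets.

Set Implicit Arguments.
Unset Strict Implicit.
Unset Printing Implicit Defensive.

Lemma ord3P (P : 'I_3 -> Prop) : P 0 -> P 1 -> P 2 -> forall i, P i.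
Proof.
move=> P0 P1 P2 [[|[|[|//]]] i3].
- by rewrite (_ : Ordinal i3 = 0)//; exact: val_inj.
- by rewrite (_ : Ordinal i3 = 1)//; exact: val_inj.
- by rewrite (_ : Ordinal i3 = 2)//; exact: val_inj.
Qed.

Lemma big_ord3 (R : Type) (idx : R) (op : Monoid.law idx) (f : 'I_3 -> R) :
  \big[op/idx]_(i < 3) f i = op (f 0) (op (f 1) (f 2)).
Proof.
rewrite !big_ord_recl big_ord0 Monoid.mulm1.
by congr (op _ (op (f _) (f _))); apply: val_inj.
Qed.

(** * Geometry of the gasket *)

Section Barycentric.
Context {R : realType}.
Implicit Types (x y : plane R) (i j : 'I_3) (w : word).

(** Barycentric coordinates with respect to the three vertices. In them every [F1 j] has the same
    form, a halving plus a shift of the [j]-th coordinate, so later case analyses are linear and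
    free of square roots. *)
Definition bary i x : R :=
  if i == 0 then x.2 * (2 / Num.sqrt 3)
  else if i == 1 then 1 - x.1 - x.2 / Num.sqrt 3
  else x.1 - x.2 / Num.sqrt 3.

Lemma sqrt3_neq0 : Num.sqrt 3 != 0 :> R.
Proof. by rewrite sqrtr_eq0 -ltNge. Qed.

Lemma bary_vtx i j : bary i (vtx j) = (i == j)%:R.
Proof.
have := sqrt3_neq0 => s0.
by move: i j; apply: ord3P; apply: ord3P; rewrite /bary /vtx /=; field.
Qed.

Lemma bary_F1 i j x : bary i (F1 j x) = (bary i x + (i == j)%:R) / 2.
Proof.
have := sqrt3_neq0 => s0; case: x => a b.
by move: i j; apply: ord3P; apply: ord3P;
  rewrite /bary /F1 /vtx /= /GRing.scale/=; field.
Qed.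

Lemma bary_sum x : \sum_i bary i x = 1.
Proof.
have := sqrt3_neq0 => s0; case: x => a b.
by rewrite big_ord3 /bary /=; field.
Qed.

Lemma bary_inj x y : (forall i, bary i x = bary i y) -> x = y.
Proof.
have := sqrt3_neq0 => s0; case: x y => [a b] [c d] e.
have {}s0 : 2 / Num.sqrt 3 != 0 :> R by rewrite mulf_neq0// invr_eq0.
have bd : b = d by have := e 0; rewrite /bary/= => /(mulIf s0).
by have := e 2; rewrite /bary/= bd => /addIr ->.
Qed.

Lemma F1K i : cancel (@F1 R i) (F1inv i).
Proof.
by move=> x; rewrite /F1inv /F1 addrK scalerA mulrC divfK// scale1r subrK.
Qed.

Lemma F1invK i : cancel (@F1inv R i) (F1 i).
Proof.
by move=> x; rewrite /F1inv /F1 addrK scalerA divfK// scale1r subrK.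
Qed.

Lemma F1_inj i : injective (@F1 R i). Proof. exact: can_inj (F1K i). Qed.

Lemma F1_vtx i : F1 i (vtx i) = vtx i :> plane R.
Proof. by rewrite /F1 subrr scaler0 add0r. Qed.

Lemma F1_vtxC i j : F1 i (vtx j) = F1 j (vtx i) :> plane R.
Proof. by apply: bary_inj => k; rewrite !bary_F1 !bary_vtx addrC. Qed.

Lemma vtx_inj : injective (@vtx R).
Proof.
move=> i j e; have [//|ij] := eqVneq i j.
have := bary_vtx i i; rewrite eqxx e bary_vtx (negbTE ij) => /esym/eqP.
by rewrite (oner_eq0 R).
Qed.

Lemma Fw_cat w v : @Fw R (w ++ v) = Fw w \o Fw v.
Proof. by apply/funext => x; elim: w => //= i w ->. Qed.

Lemma Fwinv_cat w v : @Fwinv R (w ++ v) = Fwinv v \o Fwinv w.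
Proof. by elim: w => //= i w ->. Qed.

Lemma FwK w : cancel (@Fw R w) (Fwinv w).
Proof. by elim: w => //= i w IH x /=; rewrite F1K IH. Qed.

Lemma FwinvK w : cancel (@Fwinv R w) (Fw w).
Proof. by elim: w => //= i w IH x /=; rewrite IH F1invK. Qed.

Lemma Fw_inj w : injective (@Fw R w). Proof. exact: can_inj (FwK w). Qed.

Lemma Fw_vtx n i : Fw (nseq n i) (vtx i) = vtx i :> plane R.
Proof. by elim: n => //= n ->; rewrite F1_vtx. Qed.

Lemma continuous_F1 i : continuous (@F1 R i).
Proof.
move=> x; apply: cvgD; last exact: cvg_cst.
apply: cvgZr; apply: cvgB; [exact: cvg_id|exact: cvg_cst].
Qed.

Lemma continuous_F1inv i : continuous (@F1inv R i).
Proof.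
move=> x; apply: cvgD; last exact: cvg_cst.
apply: cvgZr; apply: cvgB; [exact: cvg_id|exact: cvg_cst].
Qed.

Lemma continuous_Fwinv w : continuous (@Fwinv R w).
Proof.
elim: w => [|i w IH] x; first exact: cvg_id.
by apply: (@continuous_comp _ _ _ (F1inv i) (Fwinv w)); [exact: continuous_F1inv|exact: IH].
Qed.

Lemma continuous_bary i : continuous (bary i).
Proof.
move=> x.
have c1 : {for x, continuous (fst : plane R -> R)} by exact: cvg_fst.
have c2 : {for x, continuous (snd : plane R -> R)} by exact: cvg_snd.
move: i; apply: ord3P; rewrite /bary /=.
- by apply: cvgM => //; exact: cvg_cst.
- apply: cvgB; last by apply: cvgM => //; exact: cvg_cst.
  by apply: cvgB => //; exact: cvg_cst.
- by apply: cvgB => //; apply: cvgM => //; exact: cvg_cst.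
Qed.

End Barycentric.

(** * Position of the gasket in its triangle, and its approximating graphs *)

Section Attractor.
Context {R : realType}.
Variables (K : set (plane R)) (hK : attractor K).
Implicit Types (x y p q : plane R) (i j : 'I_3) (w v : word).
Implicit Types (u : plane R -> R).

Lemma attractor_F1 i x : K x -> K (F1 i x).
Proof. by move=> Kx; have [_ _ ->] := hK; exists i => //; exists x. Qed.

Lemma attractor_ex x : K x -> exists i y, K y /\ x = F1 i y.
Proof. by have [_ _ {1}->] := hK; move=> [i _ [y Ky <-]]; exists i, y. Qed.

Lemma attractor_Fw w x : K x -> K (Fw w x).
Proof. by elim: w => //= i w IH /IH; exact: attractor_F1. Qed.

Lemma plane_hausdorff : hausdorff_space (plane R).
Proof. exact: norm_hausdorff. Qed.

Lemma attractor_closed : closed K.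
Proof. by case: hK => _ cK _; apply: compact_closed => //; exact: plane_hausdorff. Qed.

(** The coordinate attains its minimum on the compact set [K] at some [c = F1 j y]. Then [bary i c]
    is at least [bary i y / 2], hence at least [bary i c / 2], which forces it to be nonnegative. *)
Lemma bary_ge0 i x : K x -> 0 <= bary i x.
Proof.
case: hK => K0 cK _.
have cb : {within K, continuous (bary i : plane R -> R)}.
  by apply: continuous_subspaceT; exact: continuous_bary.
have [c /set_mem Kc cmin] := compact_EVT_min K0 cK cb.
have [j [y [Ky cE]]] := attractor_ex Kc.
have yc : bary i c <= bary i y by apply: cmin; rewrite inE.
move=> Kx; have xc : bary i c <= bary i x by apply: cmin; rewrite inE.
have d0 : 0 <= (i == j)%:R :> R by rewrite ler0n.
by apply: le_trans xc; move: yc; rewrite cE bary_F1; lra.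
Qed.

Lemma bary_le1 i x : K x -> bary i x <= 1.
Proof.
move=> Kx; rewrite -(bary_sum x) (bigD1 i)//= lerDl.
by apply: sumr_ge0 => j _; exact: bary_ge0.
Qed.

Lemma bary_eq_vtx i x : K x -> 1 <= bary i x -> x = vtx i.
Proof.
move=> Kx b1; have bi : bary i x = 1 by apply/eqP; rewrite eq_le bary_le1.
apply: bary_inj => j; rewrite bary_vtx.
have [->//|ji] := eqVneq j i.
have := bary_sum x; rewrite (bigD1 i)//= (bigD1 j)//= bi.
set s := \sum_(_ | _) _; have s0 : 0 <= s.
  by apply: sumr_ge0 => k _; exact: bary_ge0.
have bj := bary_ge0 j Kx; lra.
Qed.

(** The [i]-th coordinates give [bary i y = bary i x + 1], where the right side is at least 1 and
    the left side at most 1, so [y] is the vertex [i]; [x] is treated symmetrically. *)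
Lemma F1_meet i j x y : K x -> K y -> i != j -> F1 i x = F1 j y ->
  x = vtx j /\ y = vtx i.
Proof.
move=> Kx Ky ij e.
have := congr1 (bary i) e; have := congr1 (bary j) e.
rewrite !bary_F1 !eqxx (negbTE ij) eq_sym (negbTE ij) mulr0n mulr1n => ej ei.
have := bary_ge0 i Kx; have := bary_le1 j Kx.
have := bary_le1 i Ky; have := bary_ge0 j Ky => *.
by split; apply: bary_eq_vtx => //; lra.
Qed.

(** The vertex is the limit of the iterates of [F1 i] at any point of [K], and [K] is closed. *)
Lemma attractor_vtx i : K (vtx i).
Proof.
have [[x Kx] _ _] := hK.
suff : (fun n => Fw (nseq n i) x) @ \oo --> (vtx i : plane R).
  by apply: closed_cvg attractor_closed _ _; apply: nearW => n; exact: attractor_Fw.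
have E n : Fw (nseq n i) x = (2^-1 : R) ^+ n *: (x - vtx i) + vtx i.
  elim: n => [|n IH]; first by rewrite expr0 scale1r subrK.
  by rewrite /= IH /F1 addrK scalerA exprS div1r.
rewrite (funext E) => {E}.
have : (2^-1 : R) ^+ n *: (x - vtx i) + vtx i @[n --> \oo]
    --> (0 : R) *: (x - vtx i) + vtx i.
  apply: cvgD; last exact: cvg_cst.
  apply: cvgZr_tmp; apply: cvg_expr.
  by rewrite ger0_norm ?invr_ge0// invf_lt1// ltr1n.
by rewrite scale0r add0r.
Qed.

Lemma cell_nil : cell K [::] = K.
Proof. by rewrite /cell image_id. Qed.

Lemma cell_cat w v : cell K (w ++ v) = Fw w @` cell K v.
Proof. by rewrite /cell Fw_cat image_comp. Qed.

Lemma cell_sub w : cell K w `<=` K.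
Proof. by move=> _ [x Kx <-]; exact: attractor_Fw. Qed.

Lemma cell_catS w v : cell K (w ++ v) `<=` cell K w.
Proof. by rewrite cell_cat => _ [x /cell_sub Kx <-]; exists x. Qed.

Lemma cell_prefix w v : prefix w v -> cell K v `<=` cell K w.
Proof. by move=> /prefixP[s ->]; exact: cell_catS. Qed.

Lemma cell_split n x : K x -> exists2 w, size w = n & cell K w x.
Proof.
elim: n x => [|n IH] x Kx; first by exists [::] => //; rewrite cell_nil.
have [i [y [/IH[w ws wy] ->]]] := attractor_ex Kx.
by exists (i :: w); rewrite /= ?ws// -cat1s cell_cat; exists y.
Qed.

(** An explicit list of the oriented edges, each edge in both orientations as in [En]. The recursion
    on the first letter mirrors the self-similarity of the graphs. *)
Fixpoint edges n : seq (plane R * plane R) :=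
  if n is m.+1 then
    [seq (F1 i e.1, F1 i e.2) | i <- enum 'I_3, e <- edges m]
  else [seq (vtx i, vtx (i + j)) | i <- enum 'I_3, j <- [:: 1; 2]].

Lemma edges0P p q : reflect (exists i j, [/\ i != j, p = vtx i & q = vtx j])
  ((p, q) \in edges 0).
Proof.
apply: (iffP allpairsP) => [[[i j] /=[_ jn [-> ->]]]|[i [j [ij -> ->]]]].
  exists i, (i + j); split=> //; rewrite -subr_eq0 opprD addNKr oppr_eq0.
  by move: jn; rewrite !inE => /orP[]/eqP ->.
exists (i, j - i) => /=; rewrite [i + _]addrC subrK mem_enum; split => //.
have : j - i <> 0 by move=> /eqP; rewrite subr_eq0 eq_sym; exact/negP.
by move: (j - i); apply: ord3P.
Qed.

Lemma edgesSP n p q :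
  reflect (exists i p' q', [/\ (p', q') \in edges n, p = F1 i p' & q = F1 i q'])
  ((p, q) \in edges n.+1).
Proof.
apply: (iffP allpairsP) => [[[i [a b]] /=[_ ab [-> ->]]]|[i [a [b [ab -> ->]]]]].
  by exists i, a, b.
by exists (i, (a, b)); rewrite mem_enum.
Qed.

Lemma edges_neq n p q : (p, q) \in edges n -> p <> q.
Proof.
elim: n p q => [|n IH] p q.
  by move=> /edges0P[i [j [+ -> ->]]] /vtx_inj ji; rewrite ji eqxx.
by move=> /edgesSP[i [a [b [/IH ab -> ->]]]] /F1_inj.
Qed.

Lemma edges_attractor n p q : (p, q) \in edges n -> K p /\ K q.
Proof.
elim: n p q => [|n IH] p q.
  by move=> /edges0P[i [j [_ -> ->]]]; split; exact: attractor_vtx.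
by move=> /edgesSP[i [a [b [/IH[? ?] -> ->]]]]; split; exact: attractor_F1.
Qed.

(** Two different cells of level one share at most one point, so they cannot share both ends of an
    edge. *)
Lemma edges_uniq n : uniq (edges n).
Proof.
elim: n => [|n IH].
  apply: allpairs_uniq => //; first exact: enum_uniq.
  by move=> [i j] [i' j'] /= _ _ [/vtx_inj <- /vtx_inj/addrI ->].
apply: allpairs_uniq => //; first exact: enum_uniq.
move=> _ _ /allpairsP[[k [c d]] [_ H1 ->]] /allpairsP[[k' [c' d']] [_ H2 ->]].
move=> /= e; have e1 : F1 k c = F1 k' c' := congr1 fst e.
have {e} e2 : F1 k d = F1 k' d' := congr1 snd e.
have [kk'|kk'] := eqVneq k k'.
  by move: e1 e2; rewrite kk' => /F1_inj -> /F1_inj ->.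
have [Kc Kd] := edges_attractor H1; have [Kc' Kd'] := edges_attractor H2.
have [cE _] := F1_meet Kc Kc' kk' e1; have [dE _] := F1_meet Kd Kd' kk' e2.
by case: (edges_neq H1); rewrite cE dE.
Qed.

Lemma V_vtx n i : V n (vtx i : plane R).
Proof. by exists (nseq n i), i; rewrite size_nseq Fw_vtx. Qed.

(** The word witnessing [V n.+1] may begin with a letter other than [i]; then [F1 i p] is a junction
    point and [p] is a vertex, which lies in every [V n]. *)
Lemma V_F1 n i p : K p -> V n.+1 (F1 i p) -> V n p.
Proof.
move=> Kp [[|j w] [k []]] //= [ws] e.
have [ij|ij] := eqVneq i j.
  by move: e; rewrite ij => /F1_inj ->; exists w, k.
have [->  _] := F1_meet Kp (attractor_Fw w (attractor_vtx k)) ij e.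
exact: V_vtx.
Qed.

Lemma adjE n p q : adj K n p q <-> (p, q) \in edges n.
Proof.
elim: n p q => [|n IH] p q.
  split=> [[[w [i [/size0nil -> ->]]] [v [j [/size0nil -> ->]]] /= ij _]|].
    apply/edges0P; exists i, j; split => //.
    by apply: contra_notN ij => /eqP ->.
  move=> H; have [? ?] := edges_attractor H; split; last 1 first.
  - by exists [::]; rewrite cell_nil.
  - by move: H => /edges0P[i [j [_ -> _]]]; exact: V_vtx.
  - by move: H => /edges0P[i [j [_ _ ->]]]; exact: V_vtx.
  - exact: edges_neq H.
split=> [[Vp Vq pq [[|i w] [//= [ws]]]]|].
  rewrite -cat1s cell_cat => -[p' p'w pE] [q' q'w qE]; subst p q.
  apply/edgesSP; exists i, p', q'; split => //.
  apply/IH; split; [| | |by exists w].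
  - exact: V_F1 (cell_sub p'w) Vp.
  - exact: V_F1 (cell_sub q'w) Vq.
  - by move=> e; apply: pq; rewrite e.
move=> /edgesSP[i [a [b [/IH[[w [k [ws aE]]] [v [l [vs bE]]] ab [t [ts at_ bt]]] -> ->]]]].
split.
- by exists (i :: w), k; rewrite /= ws aE.
- by exists (i :: v), l; rewrite /= vs bE.
- by move=> /F1_inj.
- exists (i :: t); rewrite /= ts -cat1s cell_cat; split => //.
  + by exists a.
  + by exists b.
Qed.

End Attractor.

(** * Energy and harmonic functions *)

Section GraphEnergy.
Context {R : realType}.
Implicit Types (u v : plane R -> R).

Definition E0 u v : R :=
  \sum_i (u (vtx i) - u (vtx (i + 1))) * (v (vtx i) - v (vtx (i + 1))).

(** The energy [En] unfolded along the first letter, so that self-similarity holds by computation.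
    Each edge of the triangle occurs once in [E0], which absorbs the factor 1 / 2 of [En]. *)
Fixpoint graph_energy n u v : R :=
  if n is m.+1 then
    rfac^-1 * \sum_i graph_energy m (u \o F1 i) (v \o F1 i)
  else E0 u v.

Lemma En_graph_energy K n u v : attractor K -> En K n u v = graph_energy n u v.
Proof.
move=> hK; rewrite /En.
transitivity (rfac ^- n * (1 / 2 * \sum_(e <- edges n)
   (u e.1 - u e.2) * (v e.1 - v e.2))).
  congr (_ * (_ * _)); rewrite [RHS]fsbig_seq; last exact: (edges_uniq hK).
  by apply: eq_fsbigl; apply/seteqP; split=> -[p q] /= /(adjE hK).
elim: n u v => [|n IH] u v.
  rewrite big_allpairs_dep /=.
  rewrite expr0 invr1 mul1r big_enum/= /E0.
  under eq_bigr do rewrite !big_cons big_nil/=.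
  rewrite !big_ord3 /=.
  have -> : 0 + 1 = 1 :> 'I_3 by exact: val_inj.
  have -> : 0 + 2 = 2 :> 'I_3 by exact: val_inj.
  have -> : 1 + 1 = 2 :> 'I_3 by exact: val_inj.
  have -> : 1 + 2 = 0 :> 'I_3 by exact: val_inj.
  have -> : 2 + 1 = 0 :> 'I_3 by exact: val_inj.
  have -> : 2 + 2 = 1 :> 'I_3 by exact: val_inj.
  by field.
rewrite big_allpairs_dep /=.
rewrite big_enum exprS invfM -[LHS]mulrA; congr (_ * _).
rewrite mulrA [LHS]mulr_sumr; apply: eq_bigr => i _; rewrite -mulrA.
by rewrite -IH.
Qed.

End GraphEnergy.

Lemma ord3_add :
  (((0 + 1)%R = 1%R :> 'I_3) * ((1 + 1)%R = 2%R :> 'I_3) *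
   ((2 + 1)%R = 0%R :> 'I_3) * ((0 + 2)%R = 2%R :> 'I_3) *
   ((1 + 2)%R = 0%R :> 'I_3) * ((2 + 2)%R = 1%R :> 'I_3))%type.
Proof. by do !split; exact: val_inj. Qed.

Lemma cvgn_eq {R : realType} (x : nat -> R) (l l' : R) :
  x @ \oo --> l -> x @ \oo --> l' -> l = l'.
Proof. by move=> xl xl'; exact: (@cvg_unique R (@Rhausdorff R) (x @ \oo)). Qed.

Section GraphEnergyTheory.
Context {R : realType}.
Implicit Types (u v f g : plane R -> R) (a b : 'I_3 -> R).

Definition bform a b : R :=
  \sum_i (a i - a (i + 1)) * (b i - b (i + 1)).

Lemma E0E u v : E0 u v = bform (u \o vtx) (v \o vtx). Proof. by []. Qed.

(* The 1/5-2/5 rule for the discrete harmonic extension: the value at the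
   vertex [F1 i (vtx j)] of the extension of the boundary data [b]. *)
Definition hext b (i j : 'I_3) : R :=
  if i == j then b i else (b 0 + b 1 + b 2 + b i + b j) / 5.

Lemma hextC b i j : hext b i j = hext b j i.
Proof. by rewrite /hext eq_sym addrAC; case: eqP => [->|]. Qed.

Lemma bform_hext b : rfac^-1 * \sum_i bform (hext b i) (hext b i) = bform b b.
Proof. by rewrite /bform !big_ord3 !ord3_add /hext/= /rfac; field. Qed.

(** Discrete harmonicity at the three midpoints: against the extension of [b], the values of [u]
    there cancel and only those on [V 0] remain. *)
Lemma E0_hext u b :
  rfac^-1 * \sum_i bform (u \o F1 i \o vtx) (hext b i) = bform (u \o vtx) b.
Proof.
rewrite /bform !big_ord3 !ord3_add /hext/= /rfac.
rewrite (F1_vtxC 1 0) (F1_vtxC 2 0) (F1_vtxC 2 1) !F1_vtx.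
by field.
Qed.

Lemma E0_le u : E0 u u <= rfac^-1 * \sum_i E0 (u \o F1 i) (u \o F1 i).
Proof.
rewrite /E0 !big_ord3 !ord3_add /= /rfac.
rewrite (F1_vtxC 1 0) (F1_vtxC 2 0) (F1_vtxC 2 1) !F1_vtx.
set a := u (vtx 0); set b := u (vtx 1); set c := u (vtx 2).
set z := u (F1 0 (vtx 1)); set y := u (F1 0 (vtx 2)); set x := u (F1 1 (vtx 2)).
(* The deviations of the midpoint values from the discrete harmonic extension. Completing the square
   makes the gain in energy a sum of squares in them. *)
pose dx := x - (a + 2 * b + 2 * c) / 5.
pose dy := y - (2 * a + b + 2 * c) / 5.
pose dz := z - (2 * a + 2 * b + c) / 5.
rewrite -subr_ge0.
have -> : (3 / 5 : R)^-1 *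
  ((a - z) * (a - z) + ((z - y) * (z - y) + (y - a) * (y - a)) +
   ((z - b) * (z - b) + ((b - x) * (b - x) + (x - z) * (x - z)) +
    ((y - x) * (y - x) + ((x - c) * (x - c) + (c - y) * (c - y))))) -
  ((a - b) * (a - b) + ((b - c) * (b - c) + (c - a) * (c - a))) =
  (5 / 3) * (2 * (dx ^+ 2 + dy ^+ 2 + dz ^+ 2) +
     (dx - dy) ^+ 2 + (dy - dz) ^+ 2 + (dz - dx) ^+ 2).
  by rewrite /dx /dy /dz; field.
have := (sqr_ge0 dx, sqr_ge0 dy, sqr_ge0 dz).
have := (sqr_ge0 (dx - dy), sqr_ge0 (dy - dz), sqr_ge0 (dz - dx)).
move=> [[h1 h2] h3] [[h4 h5] h6]; rewrite mulr_ge0//.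
do 3 apply: addr_ge0 => //; apply: mulr_ge0 => //.
by do 2 apply: addr_ge0 => //.
Qed.

Lemma rfac_gt0 : 0 < rfac :> R. Proof. by rewrite /rfac divr_gt0. Qed.

Lemma rfac_ge0 : 0 <= rfac :> R. Proof. exact: ltW rfac_gt0. Qed.

Lemma graph_energyC n u v : graph_energy n u v = graph_energy n v u.
Proof.
elim: n u v => [|n IH] u v /=; last by under eq_bigr do rewrite IH.
by apply: eq_bigr => i _; rewrite mulrC.
Qed.

Lemma graph_energyDl n c u v f :
  graph_energy n (fun x => c * u x + v x) f =
  c * graph_energy n u f + graph_energy n v f.
Proof.
elim: n u v f => [|n IH] u v f /=.
  by rewrite /E0 mulr_sumr -big_split; apply: eq_bigr => i _ /=; ring.
rewrite (eq_bigr (fun i => c * graph_energy n (u \o F1 i) (f \o F1 i) +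
  graph_energy n (v \o F1 i) (f \o F1 i))) => [|i _]; last exact: IH.
by rewrite big_split/= -mulr_sumr; ring.
Qed.

Lemma graph_energy_ge0 n u : 0 <= graph_energy n u u.
Proof.
elim: n u => [|n IH] u /=.
  by apply: sumr_ge0 => i _; rewrite -expr2 sqr_ge0.
by rewrite mulr_ge0 ?invr_ge0 ?rfac_ge0//; apply: sumr_ge0 => i _.
Qed.

Lemma graph_energy_le n u : graph_energy n u u <= graph_energy n.+1 u u.
Proof.
elim: n u => [|n IH] u; first exact: E0_le.
rewrite [leRHS]/= [leLHS]/= ler_pM2l ?invr_gt0 ?rfac_gt0//.
by apply: ler_sum => i _; exact: IH.
Qed.

Lemma nondecreasing_graph_energy u :
  nondecreasing_seq (fun n => graph_energy n u u).
Proof. by apply/nondecreasing_seqP => n; exact: graph_energy_le. Qed.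

Lemma graph_energy_ext K n u v f g : attractor K ->
  (forall x, K x -> u x = f x) -> (forall x, K x -> v x = g x) ->
  graph_energy n u v = graph_energy n f g.
Proof.
move=> hK; elim: n u v f g => [|n IH] u v f g uf vg /=.
  by apply: eq_bigr => i _; rewrite !uf ?vg//; exact: attractor_vtx.
congr (_ * _); apply: eq_bigr => i _.
by apply: IH => x Kx /=; rewrite ?uf ?vg//; exact: attractor_F1.
Qed.

End GraphEnergyTheory.

(** * The domain of the energy, and the energy as a bilinear form *)

Section Domain.
Context {R : realType}.
Variables (K : set (plane R)) (hK : attractor K).
Implicit Types (u v f g : plane R -> R) (w : word).

Notation E := (energy K).

Lemma domP u : dom K u <-> {within K, continuous u} /\
  exists M, forall n, graph_energy n u u <= M.
Proof.
by split=> -[cu [M uM]]; split=> //; exists M => n; have := uM n;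
  rewrite (En_graph_energy _ _ _ hK).
Qed.

Lemma dom_cst c : dom K (cst c).
Proof.
apply/domP; split; first by apply: continuous_subspaceT => x; exact: cvg_cst.
exists 0; elim=> [|n IH] /=.
  by rewrite /E0 big1// => i _ /=; rewrite subrr mul0r.
rewrite big1 ?mulr0// => i _; apply/eqP; rewrite eq_le graph_energy_ge0 andbT.
exact: IH.
Qed.

Lemma within_continuous_lin c u v :
  {within K, continuous u} -> {within K, continuous v} ->
  {within K, continuous (fun x => c * u x + v x)}.
Proof.
by move=> cu cv x; apply: cvgD; [apply: cvgM; [exact: cvg_cst|exact: cu]|exact: cv].
Qed.

Lemma dom_lin c u v : dom K u -> dom K v -> dom K (fun x => c * u x + v x).
Proof.
move=> /domP[cu [M uM]] /domP[cv [N vN]]; apply/domP; split.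
  exact: within_continuous_lin.
(* Parallelogram law: the energies of [c u + v] and [- c u + v] add up to at most this constant, and
   the second one is nonnegative. *)
exists (2 * c ^+ 2 * M + 2 * N) => n.
have := graph_energy_ge0 n (fun x => (- c) * u x + v x).
rewrite !graph_energyDl !(graph_energyC n _ (fun x => _ * _ + _)) !graph_energyDl.
rewrite (graph_energyC n v u) => H.
have cM : c ^+ 2 * graph_energy n u u <= c ^+ 2 * M by rewrite ler_wpM2l ?sqr_ge0.
by have := vN n; move: H cM; nra.
Qed.

Lemma domZ c u : dom K u -> dom K (fun x => c * u x).
Proof.
move=> du; have := dom_lin c du (dom_cst 0).
by rewrite (_ : (fun x => c * u x + cst 0 x) = (fun x => c * u x))//;
  apply/funext => x; rewrite addr0.
Qed.

Lemma energy_cvg_diag u : dom K u ->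
  graph_energy n u u @[n --> \oo] --> E u u.
Proof.
move=> /domP[_ [M uM]].
have -> : E u u = limn (fun n => graph_energy n u u).
  by congr (limn _); apply/funext => n; rewrite (En_graph_energy _ _ _ hK).
apply: nondecreasing_is_cvgn; first exact: nondecreasing_graph_energy.
by exists M => _ [n _ <-].
Qed.

(** Polarization reduces this to the diagonal case, where the sequence is nondecreasing and
    bounded. *)
Lemma energy_cvg u v : dom K u -> dom K v ->
  graph_energy n u v @[n --> \oo] --> E u v.
Proof.
move=> du dv.
have -> : E u v = limn (fun n => graph_energy n u v).
  by congr (limn _); apply/funext => n; rewrite (En_graph_energy _ _ _ hK).
have -> : (fun n => graph_energy n u v) = (fun n => 4^-1 *
   (graph_energy n (fun x => 1 * u x + v x) (fun x => 1 * u x + v x) -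
    graph_energy n (fun x => (-1) * u x + v x) (fun x => (-1) * u x + v x))).
  apply/funext => n.
  rewrite !graph_energyDl !(graph_energyC n _ (fun x => _ * _ + _)) !graph_energyDl.
  by rewrite (graph_energyC n v u); field.
apply: cvgP; apply: cvgM; first exact: cvg_cst.
by apply: cvgB; apply: energy_cvg_diag; exact: dom_lin.
Qed.

Lemma energyC u v : dom K u -> dom K v -> E u v = E v u.
Proof.
move=> du dv; have := energy_cvg dv du.
rewrite (_ : (fun n => _) = (fun n => graph_energy n u v)); last first.
  by apply/funext => n; rewrite graph_energyC.
by move=> /cvgn_eq h; apply/esym/h; exact: energy_cvg.
Qed.

Lemma energyDl c u v f : dom K u -> dom K v -> dom K f ->
  E (fun x => c * u x + v x) f = c * E u f + E v f.
Proof.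
move=> du dv df.
have := energy_cvg (dom_lin c du dv) df.
rewrite (_ : (fun n => _) =
  (fun n => c * graph_energy n u f + graph_energy n v f)); last first.
  by apply/funext => n; rewrite graph_energyDl.
move=> /cvgn_eq; apply.
apply: cvgD; last exact: energy_cvg.
by apply: cvgM; [exact: cvg_cst|exact: energy_cvg].
Qed.

Lemma graph_energy_le_energy n u : dom K u -> graph_energy n u u <= E u u.
Proof.
move=> du; have c := energy_cvg_diag du; rewrite -(cvg_lim _ c)//.
apply: nondecreasing_cvgn_le; first exact: nondecreasing_graph_energy.
exact: cvgP c.
Qed.

Lemma energy_ge0 u : dom K u -> 0 <= E u u.
Proof.
by move=> du; apply: (le_trans _ (graph_energy_le_energy 0 du)); exact: graph_energy_ge0.
Qed.

Lemma energy_ext u v f g : (forall x, K x -> u x = f x) ->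
  (forall x, K x -> v x = g x) -> E u v = E f g.
Proof.
move=> uf vg; congr (limn _); apply/funext => n.
by rewrite !(En_graph_energy _ _ _ hK); exact: (graph_energy_ext n hK).
Qed.

Lemma dom_F1 i u : dom K u -> dom K (u \o F1 i).
Proof.
move=> /domP[cu [M uM]]; apply/domP; split.
  apply/subspace_continuousP => x Kx.
  have /subspace_continuousP /(_ _ (attractor_F1 hK i Kx)) cu' := cu.
  suff Fw : F1 i @ within K (nbhs x) --> within K (nbhs (F1 i x)).
    exact: cvg_comp Fw cu'.
  move=> U /= nU.
  have H : nbhs x (F1 i @^-1` (fun y => K y -> U y)) := continuous_F1 nU.
  apply: (@filterS _ (nbhs x) _ _ _ _ H) => y Hy Ky.
  by apply: Hy; exact: attractor_F1.
exists (rfac * M) => n; rewrite -ler_pdivrMl ?rfac_gt0//.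
apply: (le_trans _ (uM n.+1)) => /=; rewrite ler_pM2l ?invr_gt0 ?rfac_gt0//.
rewrite (bigD1 i)//= lerDl; apply: sumr_ge0 => j _; exact: graph_energy_ge0.
Qed.

Lemma dom_Fw w u : dom K u -> dom K (u \o Fw w).
Proof. by elim: w u => [|i w IH] u //= du; apply: (IH (u \o F1 i)); exact: dom_F1. Qed.

Lemma energy_split u v : dom K u -> dom K v ->
  E u v = rfac^-1 * \sum_i E (u \o F1 i) (v \o F1 i).
Proof.
move=> du dv; have := energy_cvg du dv; rewrite -cvg_shiftS => /cvgn_eq; apply.
apply: cvgM; first exact: cvg_cst.
rewrite big_ord3; under eq_fun do rewrite big_ord3.
by apply: cvgD; [|apply: cvgD]; apply: energy_cvg; exact: dom_F1.
Qed.

End Domain.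

(** * Gluing functions along the three cells of level one *)

Section Glue.
Context {R : realType}.
Variables (K : set (plane R)) (hK : attractor K).
Implicit Types (u v g : plane R -> R) (f : 'I_3 -> plane R -> R) (w : word).

Notation E := (energy K).

Lemma energy_cst c v : E (cst c) v = 0.
Proof.
rewrite /energy (_ : (fun n => _) = cst 0) ?lim_cst//; apply/funext => n.
rewrite (En_graph_energy _ _ _ hK); elim: n v => [|n IH] v /=.
  by rewrite /E0 big1// => i _ /=; rewrite subrr mul0r.
by rewrite big1 ?mulr0// => i _; exact: IH.
Qed.

Definition glue f : plane R -> R := fun x =>
  if x \in F1 0 @` K then f 0 (F1inv 0 x)
  else if x \in F1 1 @` K then f 1 (F1inv 1 x) else f 2 (F1inv 2 x).

(** Different cells overlap only where [F1 i (vtx j) = F1 j (vtx i)], and the hypothesis says that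
    the two candidate values agree there; hence the order of the tests in [glue] does not affect the
    value. *)
Lemma glueE f i x : (forall i j, f i (vtx j) = f j (vtx i)) -> K x ->
  glue f (F1 i x) = f i x.
Proof.
move=> fC Kx.
have main j : F1 i x \in F1 j @` K -> f j (F1inv j (F1 i x)) = f i x.
  rewrite inE => -[y Ky e]; rewrite -e F1K.
  have [ij|ij] := eqVneq j i; first by move: e; rewrite ij => /F1_inj ->.
  by have [-> ->] := F1_meet hK Ky Kx ij e; rewrite fC.
have xi : F1 i x \in F1 i @` K by rewrite inE; exists x.
rewrite /glue; case: ifPn => [/main//|n0]; case: ifPn => [/main//|n1].
move: i n0 n1 xi {main}; apply: ord3P => [n0 _ xi|_ n1 xi|_ _ _].
- by rewrite xi in n0.
- by rewrite xi in n1.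
- by rewrite F1K.
Qed.

Lemma closed_F1_image i : closed (F1 i @` K).
Proof.
apply: compact_closed; first exact: plane_hausdorff.
apply: continuous_compact; last by case: hK.
by apply: continuous_subspaceT; exact: continuous_F1.
Qed.

Lemma within_F1inv i u : {within K, continuous u} ->
  {within F1 i @` K, continuous (u \o F1inv i)}.
Proof.
move=> /subspace_continuousP cu; apply/subspace_continuousP => _ [x Kx <-].
change (u (F1inv i y) @[y --> within [set F1 i y | y in K] (nbhs (F1 i x))]
  --> u (F1inv i (F1 i x))).
rewrite F1K.
suff c : F1inv i @ within (F1 i @` K) (nbhs (F1 i x)) --> within K (nbhs x).
  exact: cvg_comp c (cu _ Kx).
move=> U /= nU.
have c := @continuous_F1inv R i (F1 i x).
rewrite /continuous_at F1K in c.
have H : nbhs (F1 i x) (F1inv i @^-1` (fun y => K y -> U y)) := c _ nU.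
apply: (@filterS _ (nbhs (F1 i x)) _ _ _ _ H) => z Hz [y Ky yz].
move: Hz; rewrite -yz.
by rewrite /= F1K; exact.
Qed.

Lemma dom_glue f : (forall i, dom K (f i)) ->
  (forall i j, f i (vtx j) = f j (vtx i)) -> dom K (glue f).
Proof.
move=> fd fC; apply/(domP hK); split.
  have [_ _ KE] := hK.
  have KU : K = F1 0 @` K `|` (F1 1 @` K `|` F1 2 @` K).
    rewrite {1}KE; apply/seteqP; split=> [x [i _ H]|x].
      by move: i H; apply: ord3P => H; [left|right; left|right; right].
    by move=> [H|[H|H]]; [exists 0|exists 1|exists 2].
  have c i : {within F1 i @` K, continuous (glue f)}.
    have /(domP hK)[/within_F1inv ci _] := fd i.
    apply: subspace_eq_continuous (ci i) => y; rewrite inE => -[x Kx <-].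
    change (f i (F1inv i (F1 i x)) = glue f (F1 i x)).
    by rewrite F1K glueE.
  rewrite KU; apply: withinU_continuous => //; first exact: closed_F1_image.
    by apply: closedU; exact: closed_F1_image.
  by apply: withinU_continuous => //; exact: closed_F1_image.
have /choice[M fM] : forall i, exists M, forall n, graph_energy n (f i) (f i) <= M.
  by move=> i; have /(domP hK)[_] := fd i.
(* Level [n.+1] of the glued function is made of level [n] of the three parts; level 0 gets its own
   bound. *)
exists (Num.max (E0 (glue f) (glue f)) (rfac^-1 * \sum_i M i)) => -[|n].
  by rewrite le_max lexx.
rewrite le_max; apply/orP; right; rewrite /= ler_pM2l ?invr_gt0 ?rfac_gt0//.
apply: ler_sum => i _.
rewrite (@graph_energy_ext _ K n _ _ (f i) (f i))// => x Kx; exact: glueE.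
Qed.

End Glue.

(* The functions [h i] are the pull-backs to [K] of the pieces of [psi]; with
   the constants they interpolate arbitrary values on [V 0]. *)
Section Harmonic.
Context {R : realType}.
Variables (K : set (plane R)) (hK : attractor K) (h : 'I_3 -> plane R -> R).
Hypotheses (h_harm : forall i, harmonic_fun K (h i))
  (h0 : forall i, h i (vtx i) = 0) (h1 : forall i, h i (vtx (i + 1)) = 1)
  (h2 : forall i, h i (vtx (i + 2)) = -1).
Implicit Types (u v g : plane R -> R) (f : 'I_3 -> plane R -> R) (w : word).
Implicit Types (b : 'I_3 -> R).

Notation E := (energy K).

Let hdom i : dom K (h i). Proof. by case: (h_harm i). Qed.

Definition interpolation_const : R := 2 * (E (h 0) (h 0) + E (h 1) (h 1)).

Lemma interpolation b : exists v, [/\ dom K v, forall i, v (vtx i) = b i &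
  E v v <= interpolation_const * bform b b].
Proof.
(* The coefficients solve [- be + ga = b 0], [al + ga = b 1] and [- al + be + ga = b 2], the
   conditions on [al * h 0 + be * h 1 + ga] at the vertices. *)
pose al := (2 * b 1 - b 0 - b 2) / 3.
pose be := (b 1 + b 2 - 2 * b 0) / 3.
pose ga := (b 0 + b 1 + b 2) / 3.
pose v1 := (fun x : plane R => be * h 1 x + cst ga x).
have dv1 : dom K v1 by apply: dom_lin => //; exact: dom_cst.
pose v := (fun x : plane R => al * h 0 x + v1 x).
have dv : dom K v by exact: dom_lin.
exists v; split => //.
  have := (h0 0, h1 0, h2 0, (h0 1, h1 1, h2 1)); rewrite !ord3_add.
  move=> [[[a0 a1] a2] [[c0 c1] c2]].
  by apply: ord3P; rewrite /v /v1 /= ?a0 ?a1 ?a2 ?c0 ?c1 ?c2 /al /be /ga; field.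
have dc := dom_cst hK ga.
have Ev : E v v = al ^+ 2 * E (h 0) (h 0) + be ^+ 2 * E (h 1) (h 1) +
    2 * al * be * E (h 0) (h 1).
  rewrite energyDl// energyDl// energy_cst// addr0.
  rewrite !(energyC hK _ dv)// !energyDl// !energy_cst//.
  by rewrite (energyC hK (hdom 1) (hdom 0)); ring.
(* Nonnegativity of the energy of [- al * h 0 + be * h 1] bounds the mixed term by the two diagonal
   ones; this is the factor 2 in [interpolation_const]. *)
have := energy_ge0 hK (dom_lin hK (- al) (hdom 0) (domZ hK be (hdom 1))).
have -> : E (fun x => - al * h 0 x + be * h 1 x) (fun x => - al * h 0 x + be * h 1 x)
    = al ^+ 2 * E (h 0) (h 0) + be ^+ 2 * E (h 1) (h 1) - 2 * al * be * E (h 0) (h 1).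
  pose v2 := (fun x : plane R => be * h 1 x + cst 0 x).
  have dv2 : dom K v2 by apply: dom_lin => //; exact: dom_cst.
  pose v3 := (fun x : plane R => - al * h 0 x + v2 x).
  have dv3 : dom K v3 by exact: dom_lin.
  have -> : (fun x => - al * h 0 x + be * h 1 x) = v3.
    by apply/funext => x; rewrite /v3 /v2 /= addr0.
  rewrite energyDl// energyDl// ?energy_cst//; last exact: dom_cst.
  rewrite !(energyC hK _ dv3)// !energyDl// ?energy_cst//; try exact: dom_cst.
  by rewrite (energyC hK (hdom 1) (hdom 0)); ring.
rewrite Ev /interpolation_const.
have := energy_ge0 hK (hdom 0); have := energy_ge0 hK (hdom 1).
set e0 := E (h 0) (h 0); set e1 := E (h 1) (h 1); set e01 := E (h 0) (h 1).
move=> e1_ge0 e0_ge0 H.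
have sq (p q : R) : ((p + q) / 3) ^+ 2 <= p ^+ 2 + q ^+ 2 + (p - q) ^+ 2.
  rewrite -subr_ge0 (_ : _ - _ =
    (7 / 9) * (p ^+ 2 + q ^+ 2) + (10 / 9) * (p - q) ^+ 2); last by field.
  by rewrite addr_ge0// mulr_ge0// ?addr_ge0 ?sqr_ge0.
have al_le : al ^+ 2 <= bform b b.
  rewrite (_ : al = ((b 1 - b 0) + (b 1 - b 2)) / 3); last by rewrite /al; field.
  apply: le_trans (sq _ _) _; rewrite le_eqVlt; apply/orP; left; apply/eqP.
  by rewrite /bform big_ord3 !ord3_add/=; ring.
have be_le : be ^+ 2 <= bform b b.
  rewrite (_ : be = ((b 1 - b 0) + (b 2 - b 0)) / 3); last by rewrite /be; field.
  apply: le_trans (sq _ _) _; rewrite le_eqVlt; apply/orP; left; apply/eqP.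
  by rewrite /bform big_ord3 !ord3_add/=; ring.
have := ler_wpM2r e0_ge0 al_le; have := ler_wpM2r e1_ge0 be_le.
move: H; set B := bform b b; set a2 := al ^+ 2; set b2 := be ^+ 2; lra.
Qed.

(** The boundary data are extended by [hext] down to level [n] and then interpolated in each cell of
    that level. By [bform_hext] the energy bound does not grow with [n], and by [E0_hext] the
    level-[n] form against [v] sees only the values of [u] on [V 0]. *)
Lemma spline n b : exists v, [/\ dom K v, forall i, v (vtx i) = b i,
  E v v <= interpolation_const * bform b b &
  forall u, graph_energy n u v = bform (u \o vtx) b].
Proof.
elim: n b => [|n IH] b.
  have [v [dv vb vE]] := interpolation b; exists v; split => // u.
  by rewrite /= E0E; congr bform; apply/funext.
have /choice[f Hf] : forall i, exists v, [/\ dom K v, forall j, v (vtx j) = hext b i j,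
    E v v <= interpolation_const * bform (hext b i) (hext b i) &
    forall u, graph_energy n u v = bform (u \o vtx) (hext b i)].
  by move=> i; exact: IH.
have fd i : dom K (f i) by case: (Hf i).
have fv i j : f i (vtx j) = hext b i j by case: (Hf i).
have fC i j : f i (vtx j) = f j (vtx i) by rewrite !fv hextC.
exists (glue K f); have dg := dom_glue hK fd fC.
have gE i x : K x -> glue K f (F1 i x) = f i x by move=> ?; exact: glueE.
split => //.
- move=> i; rewrite -[vtx i]F1_vtx gE; last exact: attractor_vtx.
  by rewrite fv /hext eqxx.
- rewrite energy_split// -bform_hext mulrCA ler_pM2l ?invr_gt0 ?rfac_gt0//.
  rewrite mulr_sumr; apply: ler_sum => i _; case: (Hf i) => _ _ + _.
  by rewrite (@energy_ext _ _ hK _ _ (f i) (f i))//; exact: gE.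
- move=> u; rewrite /= -E0_hext; congr (_ * _); apply: eq_bigr => i _.
  case: (Hf i) => _ _ _ <-; apply: (graph_energy_ext n hK) => // x Kx.
  exact: gE.
Qed.

(** Letter by letter: to extend [v] from the cell [i], each other cell [j] receives an interpolating
    function with the required value [v (vtx j)] at its junction with the cell [i] and 0 at its
    other two vertices, so that everything glues. *)
Lemma extension_ex w g : dom K g ->
  exists2 v, dom K v & forall x, K x -> v (Fw w x) = g x.
Proof.
move=> dg; elim: w => [|i w [v dv vE]]; first by exists g.
have /choice[f Hf] : forall j, exists z, dom K z /\
    (if j == i then z = v else forall k, z (vtx k) = if k == i then v (vtx j) else 0).
  move=> j; case: eqP => _; first by exists v.
  have [z [dz zE _]] := interpolation (fun k => if k == i then v (vtx j) else 0).
  by exists z.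
have fd j : dom K (f j) by case: (Hf j).
have fi : f i = v by case: (Hf i) => _; rewrite eqxx.
have fj j k : j != i -> f j (vtx k) = if k == i then v (vtx j) else 0.
  by case: (Hf j) => _; case: eqP.
have fC j k : f j (vtx k) = f k (vtx j).
  have [->|ji] := eqVneq j i; have [->|ki] := eqVneq k i; rewrite ?fi//.
  - by rewrite fj// eqxx.
  - by rewrite fj// eqxx.
  - by rewrite !fj// (negbTE ji) (negbTE ki).
exists (glue K f); first exact: dom_glue.
by move=> x Kx /=; rewrite glueE// ?fi ?vE//; exact: attractor_Fw.
Qed.

(* Testing against level-[n] splines: the form [E - E_n] is positive and tends
   to [0] at [(g, g)], while splines have bounded energy. *)
Lemma harmonic_energy g v : harmonic_fun K g -> dom K v -> E g v = E0 g v.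
Proof.
move=> [dg gharm] dv; pose b := v \o vtx.
pose x := E g v - E0 g v; pose M := interpolation_const * bform b b.
(* This is the inequality of level-[n] energy and energy at [g - c * s], for the spline [s] with the
   boundary values of [v]. Harmonicity of [g] replaces [E g s] by [E g v], and the spline property
   turns the level-[n] form of [g] and [s] into [E0 g v]. *)
have key c n : 2 * c * x <= (E g g - graph_energy n g g) + c ^+ 2 * M.
  have [s [ds sb sE sh]] := spline n b.
  have Egs : E g s = E g v.
    apply/eqP; rewrite -subr_eq0; apply/eqP.
    rewrite (energyC hK dg ds) (energyC hK dg dv) -[RHS](gharm (fun x => -1 * v x + s x)).
    - rewrite (energyC hK dg (dom_lin hK (-1) dv ds)) energyDl//; ring.
    - exact: dom_lin.
    - by move=> i; rewrite sb /b /=; ring.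
  have := graph_energy_le_energy hK n (dom_lin hK (- c) ds dg).
  have dl := dom_lin hK (- c) ds dg.
  rewrite !energyDl// !(energyC hK _ dl)// !energyDl//.
  rewrite !graph_energyDl !(graph_energyC n _ (fun x => _ * _ + _)) !graph_energyDl.
  rewrite (energyC hK ds dg) (graph_energyC n s g) Egs.
  rewrite (sh g) -/b.
  have ss0 := graph_energy_ge0 n s.
  have := ler_wpM2l (sqr_ge0 c) sE; have := mulr_ge0 (sqr_ge0 c) ss0.
  rewrite /x -/M E0E -/b.
  move: (E g v) (bform _ _) (E g g) (graph_energy n g g) (E s s) (graph_energy n s s) => *.
  nra.
have {}key c : 2 * c * x <= c ^+ 2 * M.
  have : (fun n => (E g g - graph_energy n g g) + c ^+ 2 * M) @ \oo --> c ^+ 2 * M.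
    rewrite -[X in _ --> X]add0r -(subrr (E g g)).
    by apply: cvgD; [apply: cvgB; [exact: cvg_cst|exact: energy_cvg_diag]|exact: cvg_cst].
  by move=> cl; apply: (ler_cvg_to (cvg_cst _) cl); apply: nearW => n; exact: key.
have x0 : x = 0.
  have M0 : 0 <= M.
    have [s [ds _ sE _]] := spline 0 b.
    exact: le_trans (energy_ge0 hK ds) sE.
  have M1 : 0 < M + 1 by lra.
  (* With [t = x / (M + 1)] the inequality reads [2 * t ^+ 2 * (M + 1) <= t ^+ 2 * M], so [t]
     vanishes. The added 1 keeps the denominator positive. *)
  have := key (x / (M + 1)).
  have : x / (M + 1) * (M + 1) = x by rewrite divfK// gt_eqF.
  set t := x / (M + 1) => tE H.
  have t0 : t = 0 by rewrite -tE in H; nra.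
  by rewrite -tE t0 mul0r.
by apply/eqP; rewrite -subr_eq0 -/x x0.
Qed.

(* Kirchhoff's law around the central triangle. *)
Lemma sum_energy_harmonic u : dom K u -> \sum_i E (h i) (u \o F1 i) = 0.
Proof.
move=> du; rewrite (eq_bigr (fun i => E0 (h i) (u \o F1 i))) => [|i _]; last first.
  by apply: harmonic_energy => //; exact: dom_F1.
rewrite /E0 !big_ord3 !ord3_add /=.
have := (h0 0, h1 0, h2 0, (h0 1, h1 1, h2 1), (h0 2, h1 2, h2 2)); rewrite !ord3_add.
move=> [[[[-> ->] ->] [[-> ->] ->]] [[-> ->] ->]].
by rewrite (F1_vtxC 1 0) (F1_vtxC 2 0) (F1_vtxC 2 1) !F1_vtx; ring.
Qed.

End Harmonic.

(** * Cells and signed measures *)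

Lemma incomparable_words (w v : word) : ~~ prefix w v -> ~~ prefix v w ->
  exists c i j s t, [/\ i != j, w = c ++ i :: s & v = c ++ j :: t].
Proof.
elim: w v => [|i w IH] [|j v] //=.
have [->|ij] := eqVneq i j.
  move=> /IH H /H [c [k [l [s [t [kl -> ->]]]]]].
  by exists (j :: c), k, l, s, t.
by exists [::], i, j, w, v.
Qed.

Section Cells.
Context {R : realType}.
Variables (K : set (plane R)) (hK : attractor K).
Implicit Types (x y : plane R) (i j : 'I_3) (w v : word).

(** After the longest common prefix [c] the words continue with different letters, and [F1_meet]
    applies inside the cell [c]. *)
Lemma cell_meet w v : ~~ prefix w v -> ~~ prefix v w ->
  exists c i j, i != j /\ cell K w `&` cell K v `<=` [set Fw c (F1 i (vtx j))].
Proof.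
move=> wv vw; have [c [i [j [s [t [ij -> ->]]]]]] := incomparable_words wv vw.
exists c, i, j; split => // z [].
rewrite !cell_cat => -[_ [x Kx <-] <-].
move=> [_ [y Ky <-]] /Fw_inj /= /esym.
by move=> /(F1_meet hK (attractor_Fw hK s Kx) (attractor_Fw hK t Ky) ij)[-> _].
Qed.

Lemma junctionE c i j : i != j ->
  cell K (rcons c i) `&` cell K (rcons c j) = [set Fw c (F1 i (vtx j))].
Proof.
move=> ij; apply/seteqP; split=> z.
  rewrite -!cats1 !cell_cat => -[[_ [x Kx <-] <-]] [_ [y Ky <-]] /Fw_inj /= /esym.
  by move=> /(F1_meet hK Kx Ky ij)[-> _].
move=> ->; rewrite -!cats1 !cell_cat; split.
  exists (F1 i (vtx j)) => //; exists (vtx j) => //; exact: attractor_vtx.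
exists (F1 j (vtx i)); last by rewrite F1_vtxC.
by exists (vtx i) => //; exact: attractor_vtx.
Qed.

(** If [v] properly extends [w] by a letter [i] first, the vertex [i + 1] of the cell [w] is outside
    the cell [v], where that relative coordinate is at most 1 / 2. If the words are incomparable,
    the cell [w] would shrink to one point, although it has distinct vertices. *)
Lemma cell_subP w v : cell K w `<=` cell K v -> prefix v w.
Proof.
move=> wv; apply: contrapT => /negP vw.
have [wv'|wv'] := boolP (prefix w v).
  move: vw; have /prefixP[[|i s] vE] := wv'.
    by rewrite vE cats0 prefix_refl.
  have /wv : cell K w (Fw w (vtx (i + 1))).
    by exists (vtx (i + 1)) => //; exact: attractor_vtx.
  move=> + _; rewrite vE cell_cat => -[_ [x Kx <-]] /Fw_inj /= e.
  have := bary_F1 (i + 1) i (Fw s x); rewrite e bary_vtx eqxx.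
  rewrite -subr_eq0 addrAC subrr add0r /=.
  by have := bary_le1 hK (i + 1) (attractor_Fw hK s Kx); lra.
have [c [i [j [_ H]]]] := cell_meet wv' vw.
have H' k : Fw w (vtx k) = Fw c (F1 i (vtx j)) :> plane R.
  have wk : cell K w (Fw w (vtx k)) by exists (vtx k) => //; exact: attractor_vtx.
  have Q : (cell K w `&` cell K v) (Fw w (vtx k)) := conj wk (wv _ wk).
  exact: (H _ Q).
by have := H' 0; rewrite -(H' 1) => /Fw_inj/vtx_inj.
Qed.

Definition triangle : set (plane R) := [set x | forall i, 0 <= bary i x].

Lemma triangle_F1 i x : triangle x -> triangle (F1 i x).
Proof. by move=> Tx j; rewrite bary_F1 divr_ge0// addr_ge0. Qed.

Lemma triangle_Fw w x : triangle x -> triangle (Fw w x).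
Proof. by elim: w => //= i w IH /IH; exact: triangle_F1. Qed.

Lemma attractor_triangle : K `<=` triangle.
Proof. by move=> x Kx i; exact: bary_ge0 hK _ _ Kx. Qed.

(** This describes a cell inside [K] by linear inequalities, from which measurability and a
    continuous cut-off follow. The delicate points lie in the small triangle [i] but come from
    another cell [j]. *)
Lemma cell_triangle w : cell K w = K `&` Fwinv w @^-1` triangle.
Proof.
apply/seteqP; split=> x.
  move=> [y Ky <-]; split; first exact: attractor_Fw.
  by rewrite /preimage/= FwK; exact: attractor_triangle.
elim: w x => [|i w IH] x /= [Kx Tx]; first by rewrite cell_nil.
rewrite -cat1s cell_cat; exists (F1inv i x); last by rewrite /= F1invK.
apply: IH; split => //.
have [j [y [Ky xE]]] := attractor_ex hK Kx.
have [ij|ij] := eqVneq i j; first by rewrite xE ij F1K.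
have Tz : triangle (F1inv i x).
  by rewrite -[F1inv i x](FwinvK w); exact: triangle_Fw.
have : bary i x = bary i x by [].
rewrite -{1}(F1invK i x) bary_F1 eqxx {2}xE bary_F1 (negbTE ij) mulr0n mulr1n => e.
(* The two expressions of [bary i x] give [bary i y = bary i (F1inv i x) + 1], which is at least
   1. *)
have yv : y = vtx i.
  by apply: (bary_eq_vtx hK Ky); have := Tz i; lra.
by rewrite xE yv F1_vtxC F1K; exact: attractor_vtx.
Qed.

Lemma Fw_sub w x y : Fw w x - Fw w y = 2^-1 ^+ size w *: (x - y).
Proof.
elim: w => [|i w IH] /=; first by rewrite expr0 scale1r.
by rewrite /F1 opprD addrACA subrr addr0 -scalerBr opprB addrA subrK IH
  scalerA exprS div1r.
Qed.

Lemma triangle_le x : triangle x -> `|x| <= 2.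
Proof.
move=> Tx; have b := Tx; have s := bary_sum x; rewrite big_ord3 in s.
have {b} := (b 0, b 1, b 2); move: s; case: x {Tx} => p q.
rewrite /bary /= => s [[h0 h1] h2].
have s2 : Num.sqrt 3 <= 2 :> R.
  by rewrite -(ler_sqr)// ?nnegrE// sqr_sqrtr// -natrX ler_nat.
have s0 : 0 < Num.sqrt 3 :> R by rewrite sqrtr_gt0.
move: h0 h1 h2 s; set t := q / Num.sqrt 3.
have qE : q = t * Num.sqrt 3 by rewrite divfK// gt_eqF.
have -> : q * (2 / Num.sqrt 3) = 2 * t by rewrite /t; ring.
move=> h0 h1 h2 _; rewrite prod_normE /= ge_max; apply/andP; split.
  by rewrite ler_norml; apply/andP; split; lra.
rewrite qE normrM (ger0_norm (ltW s0)) ger0_norm; last lra.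
by rewrite -[leRHS]mul1r; apply: ler_pM => //; lra.
Qed.

Lemma cell_diam w x y : triangle x -> triangle y ->
  `|Fw w x - Fw w y| <= 4 * 2^-1 ^+ size w.
Proof.
move=> Tx Ty; rewrite Fw_sub normrZ ger0_norm ?exprn_ge0 ?invr_ge0// mulrC.
rewrite ler_wpM2r// ?exprn_ge0 ?invr_ge0//.
have := triangle_le Tx; have := triangle_le Ty; have := ler_normB x y; lra.
Qed.

(** A point in triangles of all levels is the limit of the corresponding [Fw w (vtx 0)], which
    belong to the closed set [K]. The formula makes [K] measurable for the product sigma-algebra. *)
Lemma attractor_bigcap :
  K = \bigcap_n \bigcup_(w in [set w : word | size w = n]) (Fwinv w @^-1` triangle).
Proof.
apply/seteqP; split=> x.
  move=> Kx n _; have [w wn [y Ky <-]] := cell_split hK n Kx.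
  by exists w => //; rewrite /preimage/= FwK; exact: attractor_triangle.
move=> Hx; have /choice[w Hw] : forall n, exists w, size w = n /\ triangle (Fwinv w x).
  by move=> n; have [w wn Tw] := Hx n I; exists w.
suff : (fun n => Fw (w n) (vtx 0)) @ \oo --> (x : plane R).
  apply: closed_cvg (attractor_closed hK) _ _; apply: nearW => n.
  by apply: attractor_Fw => //; exact: attractor_vtx.
apply/cvgrPdist_le => e e0.
have : (4 * 2^-1 ^+ n : R) @[n --> \oo] --> (4 * 0 : R).
  apply: cvgM; first exact: cvg_cst.
  by apply: cvg_expr; rewrite ger0_norm ?invr_ge0// invf_lt1// ltr1n.
rewrite mulr0 => /cvgrPdist_le/(_ e e0); apply: filterS => n.
rewrite sub0r normrN ger0_norm ?mulr_ge0 ?exprn_ge0 ?invr_ge0//; apply: le_trans.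
have [wn Tn] := Hw n.
have := cell_diam (w n) Tn (attractor_triangle (attractor_vtx hK 0)).
by rewrite FwinvK wn.
Qed.

Lemma measurable_bary i : measurable_fun [set: plane R] (bary i : plane R -> R).
Proof.
have m1 : measurable_fun [set: plane R] (fst : plane R -> R) by exact: measurable_fst.
have m2 : measurable_fun [set: plane R] (snd : plane R -> R) by exact: measurable_snd.
move: i; apply: ord3P; rewrite /bary /=.
- by apply: measurable_funM => //; exact: measurable_cst.
- apply: measurable_funB; last by apply: measurable_funM => //; exact: measurable_cst.
  by apply: measurable_funB => //; exact: measurable_cst.
- by apply: measurable_funB => //; apply: measurable_funM => //; exact: measurable_cst.
Qed.

Lemma measurable_affine (c : R) (a b : plane R) :
  measurable_fun [set: plane R] (fun x : plane R => c *: (x - a) + b).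
Proof.
have m1 : measurable_fun [set: plane R] (fst : plane R -> R) by exact: measurable_fst.
have m2 : measurable_fun [set: plane R] (snd : plane R -> R) by exact: measurable_snd.
apply: (@measurable_fun_pair _ _ _ _ _ _ (fun x : plane R => c * (x.1 - a.1) + b.1)
  (fun x : plane R => c * (x.2 - a.2) + b.2)).
- apply: measurable_funD; last exact: measurable_cst.
  apply: measurable_funM; first exact: measurable_cst.
  by apply: measurable_funB => //; exact: measurable_cst.
- apply: measurable_funD; last exact: measurable_cst.
  apply: measurable_funM; first exact: measurable_cst.
  by apply: measurable_funB => //; exact: measurable_cst.
Qed.

Lemma measurable_Fwinv w : measurable_fun [set: plane R] (@Fwinv R w).
Proof.
elim: w => [|i w IH]; first exact: measurable_id.
by apply: (@measurableT_comp _ _ _ _ _ _ (Fwinv w) _ (F1inv i)) => //; exact: measurable_affine.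
Qed.

Lemma measurable_triangle : measurable triangle.
Proof.
have -> : triangle = \bigcap_(i in [set: 'I_3]) (bary i @^-1` `[0, +oo[%classic).
  apply/seteqP; split=> x; first by move=> Tx i _; rewrite /= in_itv/= andbT.
  by move=> H i; have := H i I; rewrite /= in_itv/= andbT.
apply: fin_bigcap_measurable => // i _; rewrite -[X in measurable X]setTI.
by apply: measurable_bary => //; exact: measurable_itv.
Qed.

Lemma measurable_bigcup_words (S : set word) (F : word -> set (plane R)) :
  (forall w, measurable (F w)) -> measurable (\bigcup_(w in S) F w).
Proof.
move=> mF; rewrite bigcup_mkcond.
apply: countable_bigcupT_measurable => [|w]; first exact: countableP.
by case: ifP => // _; exact: measurable0.
Qed.

Lemma measurable_attractor : measurable K.
Proof.
rewrite attractor_bigcap; apply: bigcap_measurable => [|n _]; first by exists 0%N.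
apply: measurable_bigcup_words => w.
rewrite -[X in measurable X]setTI.
by apply: measurable_Fwinv => //; exact: measurable_triangle.
Qed.

Lemma measurable_cell w : measurable (cell K w).
Proof.
rewrite cell_triangle; apply: measurableI; first exact: measurable_attractor.
rewrite -[X in measurable X]setTI.
by apply: measurable_Fwinv => //; exact: measurable_triangle.
Qed.

End Cells.

(** * Integration against signed measures, and their uniqueness *)

Section SignedIntegral.
Context {R : realType}.
Implicit Types (nu : {charge set (plane R) -> \bar R}) (A K : set (plane R)).
Implicit Types (f : plane R -> R).

Lemma cintegralE nu : exists P N (PN : hahn_decomposition nu P N),
  forall A f, cintegral nu A f =
    Rintegral (jordan_pos PN) A f - Rintegral (jordan_neg PN) A f.
Proof.
exists (projT1 (cid (Hahn_decomposition nu))).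
exists (projT1 (cid (projT2 (cid (Hahn_decomposition nu))))).
by exists (projT2 (cid (projT2 (cid (Hahn_decomposition nu))))).
Qed.

Lemma eq_cintegral nu K f g : (forall x, K x -> f x = g x) ->
  cintegral nu K f = cintegral nu K g.
Proof.
move=> fg; have [P [N [PN E]]] := cintegralE nu; rewrite !E.
by congr (_ - _); apply: eq_Rintegral => x; rewrite inE => /fg.
Qed.

Lemma cintegral_indic nu K A : measurable K -> measurable A ->
  cintegral nu K \1_A = fine (nu (A `&` K)).
Proof.
move=> mK mA; have [P [N [PN ->]]] := cintegralE nu.
have mAK : measurable (A `&` K) by exact: measurableI.
rewrite /Rintegral !integral_indic// (jordan_decomp PN mAK) /cadd /= /cscale.
have p : jordan_pos PN (A `&` K) \is a fin_num by rewrite fin_num_measure.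
have n : jordan_neg PN (A `&` K) \is a fin_num by rewrite fin_num_measure.
by rewrite EFinN mulN1e fineD ?fin_numN// fineN.
Qed.

Lemma Rintegral_dominated_cvg (mu : {finite_measure set (plane R) -> \bar R})
    K (f_ : nat -> plane R -> R) f (M : R) : measurable K ->
  (forall n, measurable_fun K (f_ n)) -> (forall x, K x -> f_ n x @[n --> \oo] --> f x) ->
  (forall n x, K x -> `|f_ n x| <= M) ->
  Rintegral mu K (f_ n) @[n --> \oo] --> Rintegral mu K f.
Proof.
move=> mK mf f_f fM.
have mfK : measurable_fun K f.
  exact: (measurable_fun_cvg mf).
have := @dominated_convergence _ _ _ mu K mK (fun n => EFin \o f_ n) (EFin \o f)
  (cst M%:E).
case.
- by move=> n; exact/measurable_EFinP.
- exact/measurable_EFinP.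
- by apply: aeW => x Kx; apply: cvg_EFin; [exact: nearW|exact: f_f].
- exact: finite_measure_integrable_cst.
- by apply: aeW => x n Kx; rewrite /= lee_fin; exact: fM.
move=> fint _ H; apply: fine_cvg; rewrite fineK//.
exact: integrable_fin_num.
Qed.

Lemma cintegral_dominated_cvg nu K (f_ : nat -> plane R -> R) f (M : R) :
  measurable K -> (forall n, measurable_fun K (f_ n)) ->
  (forall x, K x -> f_ n x @[n --> \oo] --> f x) ->
  (forall n x, K x -> `|f_ n x| <= M) ->
  cintegral nu K (f_ n) @[n --> \oo] --> cintegral nu K f.
Proof.
move=> mK mf f_f fM; have [P [N [PN E]]] := cintegralE nu.
rewrite E (funext (fun n => E K (f_ n))).
by apply: cvgB; apply: Rintegral_dominated_cvg mf f_f fM.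
Qed.

Lemma fine_charge_setU nu A B : measurable A -> measurable B ->
  fine (nu (A `|` B)) = fine (nu A) + fine (nu B) - fine (nu (A `&` B)).
Proof.
move=> mA mB.
have f X : measurable X -> nu X \is a fin_num by move=> mX; exact: fin_num_measure.
have -> : A `|` B = A `|` (B `\` A).
  apply/seteqP; split=> x [Ax|]; [by left| |by left|by move=> []; right].
  by have [Ax|nAx] := pselect (A x); [left|right].
have mBA : measurable (B `\` A) by exact: measurableD.
have mAB : measurable (A `&` B) by exact: measurableI.
rewrite chargeU//; last by rewrite setDE setICA setICr setI0.
rewrite (chargeDI nu mB mA) (setIC B) !fineD ?f//; ring.
Qed.

(** A pi-lambda argument. Cells alone are not stable under intersection, since two of them may meet
    in a junction point; this is why the values at junction points enter the hypotheses. *)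
Lemma charge_uniq K nu nu' : attractor K ->
  (forall w, nu (cell K w) = nu' (cell K w)) ->
  (forall c i j, i != j -> nu [set Fw c (F1 i (vtx j))] = 0%E) ->
  (forall c i j, i != j -> nu' [set Fw c (F1 i (vtx j))] = 0%E) ->
  forall A, measurable A -> A `<=` K -> nu A = nu' A.
Proof.
move=> hK nucell nu0 nu'0.
have mK := measurable_attractor hK.
(* The generating pi-system consists of sets of the plane and records only their trace on [K]; the
   case of an empty trace supplies everything outside [K]. *)
pose G : set (set (plane R)) := [set S | measurable S /\
  [\/ exists w, S `&` K = cell K w,
    exists c i j, i != j /\ S `&` K = [set Fw c (F1 i (vtx j))] | S `&` K = set0]].
have Gsub S p : measurable S -> (exists c i j, i != j /\ p = Fw c (F1 i (vtx j))) ->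
    S `&` K `<=` [set p] -> G S.
  move=> mS [c [i [j [ij ->]]]] /subset_set1[S0|S1]; split => //; first exact: Or33.
  by apply: Or32; exists c, i, j.
have Gcell w : G (cell K w).
  split; first exact: measurable_cell.
  by apply: Or31; exists w; rewrite setIidl//; exact: cell_sub.
(* The part in [K] of an open sublevel set of a 1-Lipschitz function is a countable union of cells:
   around each point a cell of diameter at most [4 * 2^-1 ^+ n] still fits. *)
have half (f : plane R -> R) (a : R) : measurable_fun setT f ->
    (forall x y, `|f x - f y| <= `|x - y|) -> <<s G >> [set x | f x < a].
  move=> mf f_lip; pose H := [set x | f x < a].
  have mH : measurable H.
    rewrite (_ : H = setT `&` f @^-1` `]-oo, a[%classic).
      by apply: mf => //; exact: measurable_itv.
    by apply/seteqP; split=> x; rewrite /= in_itv/=; [split|case].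
  have HE : H = (H `\` K) `|` \bigcup_(w in [set w | cell K w `<=` H]) cell K w.
    apply/seteqP; split=> x; last by move=> [[]//|[w wH /wH]].
    move=> Hx; have [Kx|nKx] := pselect (K x); last by left.
    right; have ax : 0 < a - f x by rewrite subr_gt0.
    have : (4 * 2^-1 ^+ n : R) @[n --> \oo] --> (4 * 0 : R).
      apply: cvgM; first exact: cvg_cst.
      by apply: cvg_expr; rewrite ger0_norm ?invr_ge0// invf_lt1// ltr1n.
    rewrite mulr0 => /cvgrPdist_lt/(_ _ ax)[n _ /(_ n (leqnn n))].
    rewrite /= sub0r normrN ger0_norm ?mulr_ge0 ?exprn_ge0 ?invr_ge0// => nx.
    have [w wn wx] := cell_split hK n Kx; exists w => //= y wy.
    have [[x' Kx' xE] [y' Ky' yE]] := (wx, wy).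
    have := cell_diam w (attractor_triangle hK Ky') (attractor_triangle hK Kx').
    rewrite xE yE wn => d; have := le_trans (f_lip y x) d; rewrite ler_norml => /andP[_].
    rewrite /H /=; lra.
  have mG S : G S -> <<s G >> S by exact: sub_sigma_algebra.
  rewrite -/H HE; apply: (@measurableU _ (g_sigma_algebraType G)).
    apply: mG; split; first exact: measurableD.
    by apply: Or33; rewrite setDE -setIA setICl setI0.
  rewrite bigcup_mkcond.
  have mU (F : word -> set (plane R)) (mF : forall w, <<s G >> (F w)) :
      <<s G >> (\bigcup_w F w).
    exact: (@countable_bigcupT_measurable _ (g_sigma_algebraType G) _ F (countableP _)).
  apply: mU => w.
  case: ifP => // _; first exact: mG (Gcell w).
  exact: (@measurable0 _ (g_sigma_algebraType G)).
(* Applied to the two coordinates, [half] makes both projections measurable for the sigma-algebra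
   generated by [G], which therefore contains the product one. *)
have mG : @measurable _ (plane R) = <<s G >>.
  apply/seteqP; split; last first.
    by apply: smallest_sub => [|S []//]; exact: sigma_algebra_measurable.
  move=> S mS; pose T := g_sigma_algebraType G.
  have m1 : measurable_fun setT (fun x : T => (x : plane R).1).
    apply: (measurability _ (RGenInftyO.measurableE R)) => _ [_ [a ->] <-].
    rewrite setTI; have := half (fst : plane R -> R) a.
    rewrite (_ : _ @^-1` _ = [set x : plane R | x.1 < a]); last first.
      by apply/seteqP; split=> x; rewrite /= in_itv.
    apply => [|x y]; first exact: measurable_fst.
    by rewrite prod_normE le_max lexx.
  have m2 : measurable_fun setT (fun x : T => (x : plane R).2).
    apply: (measurability _ (RGenInftyO.measurableE R)) => _ [_ [a ->] <-].
    rewrite setTI; have := half (snd : plane R -> R) a.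
    rewrite (_ : _ @^-1` _ = [set x : plane R | x.2 < a]); last first.
      by apply/seteqP; split=> x; rewrite /= in_itv.
    apply => [|x y]; first exact: measurable_snd.
    by rewrite prod_normE le_max lexx orbT.
  have := measurable_fun_pair m1 m2 measurableT mS; rewrite setTI.
  by rewrite (_ : _ @^-1` S = S)//; apply/seteqP; split=> -[].
have key : forall S, <<s G >> S -> nu (S `&` K) = nu' (S `&` K).
  apply: (dynkin_induction mG).
  - move=> S S' [mS GS] [mS' GS']; have mSS' := measurableI _ _ mS mS'.
    have SE : S `&` S' `&` K = (S `&` K) `&` (S' `&` K) by rewrite setIACA setIid.
    case: GS => [[w Sw]|[c [i [j [ij Sp]]]]|S0]; last first.
    + by split => //; apply: Or33; rewrite SE S0 set0I.
    + apply: (Gsub _ (Fw c (F1 i (vtx j)))) => //; first by exists c, i, j.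
      by rewrite SE Sp; exact: subIsetl.
    case: GS' => [[w' Sw']|[c [i [j [ij Sp]]]]|S0]; last first.
    + by split => //; apply: Or33; rewrite SE S0 setI0.
    + apply: (Gsub _ (Fw c (F1 i (vtx j)))) => //; first by exists c, i, j.
      by rewrite SE Sp; exact: subIsetr.
    have [ww'|ww'] := boolP (prefix w w').
      split => //; apply: Or31; exists w'; rewrite SE Sw Sw' setIidr//.
      exact: (cell_prefix hK).
    have [w'w|w'w] := boolP (prefix w' w).
      split => //; apply: Or31; exists w; rewrite SE Sw Sw' setIidl//.
      exact: (cell_prefix hK).
    have [c [i [j [ij H]]]] := cell_meet hK ww' w'w.
    apply: (Gsub _ (Fw c (F1 i (vtx j)))) => //; first by exists c, i, j.
    by rewrite SE Sw Sw'.
  - by rewrite setTI -(cell_nil K).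
  - move=> S [_ [[w ->]|[c [i [j [ij ->]]]]|->]]; first exact: nucell.
      by rewrite nu0// nu'0.
    by rewrite !charge0.
  - move=> S mS PS.
    have E (m : {charge set (plane R) -> \bar R}) :
        m (~` S `&` K) = (m K - m (S `&` K))%E.
      rewrite (chargeDI m mK mS) setIC -setDE (setIC S) addeK//.
      by apply: fin_num_measure; exact: measurableI.
    by rewrite !E PS -(cell_nil K) nucell.
  - move=> F mF tF PF; rewrite setI_bigcupl.
    have mFK n : measurable (F n `&` K) by exact: measurableI.
    have tFK : trivIset setT (fun n => F n `&` K).
      apply/trivIsetP => i j _ _ ij; rewrite setIACA.
      by move/trivIsetP: tF => ->//; rewrite set0I.
    have mU : measurable (\bigcup_n (F n `&` K)) by exact: bigcup_measurable.
    have c1 := @charge_semi_sigma_additive _ _ _ nu _ mFK tFK mU.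
    have c2 := @charge_semi_sigma_additive _ _ _ nu' _ mFK tFK mU.
    have e : (fun n => \sum_(0 <= k < n) nu (F k `&` K))%E =
        (fun n => \sum_(0 <= k < n) nu' (F k `&` K))%E.
      by apply/funext => n; apply: eq_bigr => k _; exact: PF.
    by move: c1; rewrite e => /cvg_lim <-//; move/cvg_lim: c2 => <-.
move=> A mA AK; have := key A; rewrite setIidl//; apply.
by rewrite -mG.
Qed.

End SignedIntegral.

Section ChargeCells.
Context {R : realType}.

(** Inclusion-exclusion for the three subcells: the pairwise intersections are the junction points,
    and the triple intersection is empty. *)
Lemma fine_charge_cell (K : set (plane R)) (nu : {charge set (plane R) -> \bar R}) w :
  attractor K ->
  fine (nu (cell K w)) = \sum_i fine (nu (cell K (rcons w i))) -
    \sum_i fine (nu [set Fw w (F1 i (vtx (i + 1)))]).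
Proof.
move=> hK; have m := measurable_cell hK.
have wE : cell K w = cell K (rcons w 0) `|` (cell K (rcons w 1) `|` cell K (rcons w 2)).
  apply/seteqP; split=> x.
    move=> [y Ky <-]; have [i [z [Kz ->]]] := attractor_ex hK Ky.
    have H : cell K (rcons w i) (Fw w (F1 i z)).
      by rewrite -cats1 cell_cat; exists (F1 i z) => //; exists z.
    by move: i H; apply: ord3P => H; [left|right; left|right; right].
  have sub i : cell K (rcons w i) `<=` cell K w.
    by rewrite -cats1; exact: (cell_catS hK).
  by move=> [/sub//|[/sub//|/sub//]].
have j01 := junctionE hK w (isT : 0 != 1 :> 'I_3).
have j02 := junctionE hK w (isT : 2 != 0 :> 'I_3).
have j12 := junctionE hK w (isT : 1 != 2 :> 'I_3).
rewrite setIC in j02.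
rewrite [in LHS]wE fine_charge_setU//; last exact: measurableU.
rewrite fine_charge_setU// setIUr fine_charge_setU//; try exact: measurableI.
rewrite j01 j02 j12 (_ : _ `&` _ = set0); last first.
  apply/seteqP; split=> x //= [-> /Fw_inj]; rewrite F1_vtxC.
  by rewrite (F1_vtxC 2 0) F1_vtxC => /F1_inj/vtx_inj.
by rewrite charge0 !big_ord3 !ord3_add /=; ring.
Qed.

Lemma cintegral_indicZ (K A : set (plane R)) (nu : {charge set (plane R) -> \bar R})
    (c : R) : measurable K -> measurable A ->
  cintegral nu K (fun x => c * \1_A x) = c * fine (nu (A `&` K)).
Proof.
move=> mK mA; rewrite -cintegral_indic//; have [P [N [PN E]]] := cintegralE nu.
rewrite !E mulrBr; congr (_ - _); rewrite RintegralZl//.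
  by apply: (integrableS measurableT) => //; exact: integrable_indic.
by apply: (integrableS measurableT) => //; exact: integrable_indic.
Qed.

End ChargeCells.

(** * One-forms *)

Section DotProduct.
Context {R : realType} {H : completeNormedModType R} (dot : {dot H for idfun}).
Hypothesis dot_norm : forall om, dot om om = `|om| ^+ 2.
Implicit Types (x y z : H).

Lemma dotC x y : dot x y = dot y x.
Proof. by rewrite hermC expr0 mul1r. Qed.

Lemma dotDl x y z : dot (x + y) z = dot x z + dot y z.
Proof. exact: linearDl. Qed.

Lemma dotZl c x y : dot (c *: x) y = c * dot x y.
Proof. exact: linearZl_LR. Qed.

Lemma dotDr x y z : dot x (y + z) = dot x y + dot x z.
Proof. by rewrite dotC dotDl !(dotC x). Qed.

Lemma dotZr c x y : dot x (c *: y) = c * dot x y.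
Proof. by rewrite dotC dotZl dotC. Qed.

Lemma dotNl x y : dot (- x) y = - dot x y.
Proof. by rewrite -scaleN1r dotZl mulN1r. Qed.

Lemma dotNr x y : dot x (- y) = - dot x y.
Proof. by rewrite dotC dotNl dotC. Qed.

Lemma dot0l x : dot 0 x = 0.
Proof. by rewrite -(scale0r 0) dotZl mul0r. Qed.

Lemma dot0r x : dot x 0 = 0. Proof. by rewrite dotC dot0l. Qed.

Lemma dot_suml (I : Type) (r : seq I) (P : pred I) (F : I -> H) y :
  dot (\sum_(i <- r | P i) F i) y = \sum_(i <- r | P i) dot (F i) y.
Proof. by elim/big_rec2: _ => [|i a b _ <-]; rewrite ?dot0l ?dotDl. Qed.

Lemma dot_sumr (I : Type) (r : seq I) (P : pred I) (F : I -> H) y :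
  dot y (\sum_(i <- r | P i) F i) = \sum_(i <- r | P i) dot y (F i).
Proof. by rewrite dotC dot_suml; apply: eq_bigr => i _; rewrite dotC. Qed.

(** The triangle inequality of the given norm, squared and expanded. *)
Lemma dot_le x y : dot x y <= `|x| * `|y|.
Proof.
have H2 : `|x + y| ^+ 2 <= (`|x| + `|y|) ^+ 2.
  by rewrite ler_sqr ?nnegrE ?addr_ge0//; exact: ler_normD.
by move: H2; rewrite -dot_norm !dotDl !dotDr (dotC y x) !dot_norm; nra.
Qed.

Lemma dot_eq0 x : dot x x = 0 -> x = 0.
Proof.
by rewrite dot_norm => /eqP; rewrite sqrf_eq0 normr_eq0 => /eqP.
Qed.

(** Polarization expresses [dot] through the norm, and continuity is inherited from there. *)
Lemma dot_cvg (T : Type) (F : set_system T) {FF : Filter F} (f g : T -> H) x y :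
  f @ F --> x -> g @ F --> y -> dot (f t) (g t) @[t --> F] --> dot x y.
Proof.
move=> fx gy.
have polar a b : dot a b = 4^-1 * (`|a + b| ^+ 2 - `|a - b| ^+ 2).
  by rewrite -!dot_norm !dotDl !dotDr !dotNl !dotNr (dotC b a); field.
rewrite polar (funext (fun t => polar (f t) (g t))).
apply: cvgM; first exact: cvg_cst.
by apply: cvgB; (under eq_fun do rewrite expr2); rewrite expr2; apply: cvgM;
  apply: cvg_norm; [exact: cvgD|exact: cvgD|exact: cvgB|exact: cvgB].
Qed.

End DotProduct.

(** * Sums over the words of a given length *)

Section Words.

Fixpoint words n : seq word :=
  if n is m.+1 then [seq i :: w | i <- enum 'I_3, w <- words m] else [:: [::]].

Lemma mem_words n w : (w \in words n) = (size w == n).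
Proof.
elim: n w => [|n IH] w; first by rewrite inE size_eq0.
apply/allpairsP/idP => [[[i v] /=[_ + ->]]|]; first by rewrite IH /= eqSS.
by case: w => [|i v]//=; rewrite eqSS -IH => vn; exists (i, v); rewrite mem_enum.
Qed.

Lemma words_uniq n : uniq (words n).
Proof.
elim: n => //= n IH; apply: allpairs_uniq => //; first exact: enum_uniq.
by move=> [i w] [j v] _ _ /= [-> ->].
Qed.

Variables (V : nmodType).
Implicit Types (F : word -> V).

Lemma big_words_cons n F :
  \sum_(w <- words n.+1) F w = \sum_i \sum_(w <- words n) F (i :: w).
Proof. by rewrite big_allpairs_dep big_enum. Qed.

Lemma big_tuple_words n F : \sum_(t : n.-tuple 'I_3) F t = \sum_(w <- words n) F w.
Proof.
rewrite -(big_enum _ _ _ (fun t : n.-tuple _ => F t))/= -(big_map val xpredT F).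
apply: perm_big; apply: uniq_perm; last 1 first.
- move=> w; rewrite mem_words; apply/mapP/eqP => [[t _ ->]|wn]; first exact: size_tuple.
  by exists (tcast wn (in_tuple w)); rewrite ?mem_enum//= val_tcast.
- by rewrite map_inj_uniq ?enum_uniq//; exact: val_inj.
- exact: words_uniq.
Qed.

Lemma big_words_prefix w n (P : pred word) F :
  \sum_(b <- words (size w + n) | prefix w b && P b) F b =
  \sum_(s <- words n | P (w ++ s)) F (w ++ s).
Proof.
rewrite -(big_map (cat w) P F) -big_filter_cond [LHS]big_mkcond [RHS]big_mkcond.
apply: perm_big; apply: uniq_perm.
- by rewrite filter_uniq// words_uniq.
- by rewrite map_inj_uniq ?words_uniq// => s t /eqP; rewrite eqseq_cat// eqxx => /eqP.
move=> b; rewrite mem_filter mem_words; apply/andP/mapP.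
  move=> [/prefixP[s ->]]; rewrite size_cat eqn_add2l -mem_words => sn.
  by exists s.
by move=> [s + ->]; rewrite mem_words prefix_prefix size_cat eqn_add2l.
Qed.

Lemma big_words_cat n m F :
  \sum_(w <- words (n + m)) F w = \sum_(v <- words n) \sum_(s <- words m) F (v ++ s).
Proof.
elim: n F => [|n IH] F; first by rewrite /= big_seq1.
by rewrite addSn !big_words_cons; apply: eq_bigr => i _; rewrite IH.
Qed.

End Words.

(** * Multiplication of one-forms by continuous functions and by indicators of cells *)

Section BorelAction.
Context {R : realType}.
Variables (K : set (plane R)) (hK : attractor K).
Variables (nu : (plane R -> R) -> (plane R -> R) -> {charge set (plane R) -> \bar R})
  (hnu : forall u v, dom K u -> dom K v -> energy_measure K u v (nu u v))
  (H : completeNormedModType R) (dot : {dot H for idfun})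
  (symb : (plane R -> R) -> (plane R -> R) -> H)
  (hH : one_form_space K dot symb nu)
  (act : (plane R -> R) -> H -> H)
  (hact : borel_action K dot symb act nu)
  (nuH : H -> H -> {charge set (plane R) -> \bar R})
  (hnuH : forall om om', form_measure K dot act om om' (nuH om om')).
Implicit Types (x y z : H) (f g u v phi psi : plane R -> R) (w : word).

Let dnorm := dot_norm hH.
Let mK : measurable K := measurable_attractor hK.

Notation bb := (bounded_borel K).

Lemma symb_dense_ind (P : set H) : closed P -> P 0 ->
  (forall x y, P x -> P y -> P (x + y)) ->
  (forall f u, {within K, continuous f} -> dom K u -> P (symb f u)) ->
  forall x, P x.
Proof.
move=> cP P0 PD Ps x.
have : [set: H] x by [].
rewrite -(sym_dense hH) (proj1 (closure_id P) cP); apply: closure_subset => y [s sP ->].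
elim: s sP => [|p s IH] sP; first by rewrite big_nil.
rewrite big_cons; apply: PD.
  by apply: Ps; have [] := sP p (mem_head _ _).
by apply: IH => q qs; apply: sP; rewrite inE qs orbT.
Qed.

Lemma closed_eqH (V : normedModType R) (a b : H -> V) :
  continuous a -> continuous b -> closed [set x | a x = b x].
Proof.
move=> ca cb.
have -> : [set x | a x = b x] = (fun x => a x - b x) @^-1` [set 0].
  by apply/seteqP; split=> x /= => [->|/subr0_eq//]; rewrite subrr.
apply: preimage_closed.
  by move=> x _; apply: cvgB; [exact: ca|exact: cb].
apply: accessible_closed_set1; apply: hausdorff_accessible; exact: norm_hausdorff.
Qed.

Lemma dot_eq0_symb x : (forall f u, {within K, continuous f} -> dom K u ->
  dot x (symb f u) = 0) -> x = 0.
Proof.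
move=> hx; apply: (dot_eq0 dnorm).
apply: (@symb_dense_ind (fun y => dot x y = 0)) => //.
- apply: (@closed_eqH R (dot x) (fun=> 0)).
    by move=> y; apply: (dot_cvg dnorm); [exact: cvg_cst|exact: cvg_id].
  by move=> y; exact: cvg_cst.
- by rewrite dot0r.
- by move=> y z; rewrite dotDr => -> ->; rewrite addr0.
Qed.

Lemma dot_inj_symb x y : (forall f u, {within K, continuous f} -> dom K u ->
  dot x (symb f u) = dot y (symb f u)) -> x = y.
Proof.
move=> xy; apply/eqP; rewrite -subr_eq0; apply/eqP/dot_eq0_symb => f u cf du.
by rewrite dotDl dotNl xy// subrr.
Qed.

Lemma actD phi x y : bb phi -> act phi (x + y) = act phi x + act phi y.
Proof. by move=> b; have := act_linear hact b 1 x y; rewrite !scale1r. Qed.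

Lemma act0r phi : bb phi -> act phi 0 = 0.
Proof.
by move=> b; have := act_linear hact b (-1) 0 0; rewrite !scaleN1r addr0 oppr0 addNr.
Qed.

Lemma act_sum phi (I : Type) (r : seq I) (P : pred I) (F : I -> H) : bb phi ->
  act phi (\sum_(i <- r | P i) F i) = \sum_(i <- r | P i) act phi (F i).
Proof.
by move=> b; elim/big_rec2: _ => [|i a c _ <-]; rewrite ?act0r ?actD.
Qed.

(** Tested against symbols, both sides are integrals over [K] for the same form measure. *)
Lemma act_eq phi psi x : bb phi -> bb psi -> (forall p, K p -> phi p = psi p) ->
  act phi x = act psi x.
Proof.
move=> b1 b2 e; apply: dot_inj_symb => f u cf du.
have [_ h] := hnuH x (symb f u); rewrite -!h//.
exact: eq_cintegral.
Qed.

Lemma bbM phi psi : bb phi -> bb psi -> bb (phi \* psi).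
Proof.
move=> [m1 [M1 b1]] [m2 [M2 b2]]; split; first exact: measurable_funM.
exists (M1 * M2) => p Kp; rewrite normrM ler_pM//; [exact: b1|exact: b2].
Qed.

Lemma bb_indic A : measurable A -> bb \1_A.
Proof.
move=> mA; split; first exact: measurable_indic.
by exists 1 => p _; rewrite ger0_norm// indicE lern1 leq_b1.
Qed.

Lemma bb_cst c : bb (cst c).
Proof. by split; [exact: measurable_cst|exists `|c|]. Qed.

Lemma within_continuousM f g : {within K, continuous f} ->
  {within K, continuous g} -> {within K, continuous (f \* g)}.
Proof. by move=> cf cg x; apply: cvgM; [exact: cf|exact: cg]. Qed.

Lemma act_symb phi f u : bb phi -> {within K, continuous phi} ->
  {within K, continuous f} -> dom K u -> act phi (symb f u) = symb (phi \* f) u.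
Proof.
move=> b c cf du; apply: dot_inj_symb => g v cg dv.
by rewrite (act_sym hact)// (dot_sym hH)//; exact: within_continuousM.
Qed.

Lemma act_cont_adj phi x y : bb phi -> {within K, continuous phi} ->
  dot (act phi x) y = dot x (act phi y).
Proof.
move=> b c; have ac := act_continuous hact b.
apply: (@symb_dense_ind (fun x => dot (act phi x) y = dot x (act phi y))).
- apply: (@closed_eqH R (fun x => dot (act phi x) y) (fun x => dot x (act phi y))).
  + by move=> z; apply: (dot_cvg dnorm); [exact: ac|exact: cvg_cst].
  + by move=> z; apply: (dot_cvg dnorm); [exact: cvg_id|exact: cvg_cst].
- by rewrite act0r// !dot0l.
- by move=> x1 x2 e1 e2; rewrite actD// !dotDl e1 e2.
move=> f u cf du.
apply: (@symb_dense_ind (fun y => dot (act phi (symb f u)) y = dot (symb f u) (act phi y))).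
- apply: (@closed_eqH R (fun y => dot (act phi (symb f u)) y)
    (fun y => dot (symb f u) (act phi y))).
  + by move=> z; apply: (dot_cvg dnorm); [exact: cvg_cst|exact: cvg_id].
  + by move=> z; apply: (dot_cvg dnorm); [exact: cvg_cst|exact: ac].
- by rewrite act0r// !dot0r.
- by move=> x1 x2 e1 e2; rewrite actD// !dotDr e1 e2.
move=> g v cg dv; rewrite !act_symb//.
rewrite !(dot_sym hH)//; try exact: within_continuousM.
by congr cintegral; apply/funext => p /=; rewrite mulrCA mulrA.
Qed.

(** Self-adjointness moves the continuous [phi] onto the test symbol, which stays a symbol, so that
    [act_sym] evaluates both sides. *)
Lemma act_cont_mul phi psi x : bb phi -> {within K, continuous phi} -> bb psi ->
  act phi (act psi x) = act (phi \* psi) x.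
Proof.
move=> b c b'; have b2 := bbM b b'.
apply: (@symb_dense_ind (fun x => act phi (act psi x) = act (phi \* psi) x)).
- apply: (@closed_eqH H (fun x => act phi (act psi x)) (act (phi \* psi))).
  + move=> z; apply: (@continuous_comp _ _ _ (act psi) (act phi)).
      exact: (act_continuous hact b').
    exact: (act_continuous hact b).
  + exact: (act_continuous hact b2).
- by rewrite !act0r.
- by move=> x1 x2 e1 e2; rewrite !actD// e1 e2.
move=> f u cf du; apply: dot_inj_symb => g v cg dv.
rewrite act_cont_adj// (act_symb b c cg dv) !(act_sym hact)//; last first.
  exact: within_continuousM.
by congr cintegral; apply/funext => p /=; rewrite mulrCA !mulrA.
Qed.

(** Dominated convergence for the form measure of [x] and [y], applied to its positive and negative
    parts. *)
Lemma act_weak_cvg (phi_ : nat -> plane R -> R) phi M x y :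
  (forall n, measurable_fun K (phi_ n)) -> bb phi ->
  (forall p, K p -> phi_ n p @[n --> \oo] --> phi p) ->
  (forall n p, K p -> `|phi_ n p| <= M) ->
  dot (act (phi_ n) x) y @[n --> \oo] --> dot (act phi x) y.
Proof.
move=> m b c le; have [_ h] := hnuH x y; rewrite -h//.
have e n : dot (act (phi_ n) x) y = cintegral (nuH x y) K (phi_ n).
  by rewrite h//; split => //; exists M => p; exact: le.
rewrite (funext e); exact: cintegral_dominated_cvg le.
Qed.

(* Equal to [1] exactly on [cell K w], so that its powers decrease to the
   indicator function of the cell. *)
Definition cell_cut w (p : plane R) : R :=
  expR (- \sum_i (`|bary i (Fwinv w p)| - bary i (Fwinv w p))).

Lemma cell_cut_ge0 w p : 0 <= cell_cut w p.
Proof. exact: expR_ge0. Qed.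

Lemma cell_cut_le1 w p : cell_cut w p <= 1.
Proof.
rewrite -expR0 ler_expR oppr_le0; apply: sumr_ge0 => i _.
by rewrite subr_ge0 ler_norm.
Qed.

Lemma cell_cut1 w p : K p -> (cell_cut w p == 1) = (p \in cell K w).
Proof.
move=> Kp; rewrite (cell_triangle hK) /cell_cut -expR0 (inj_eq (@expR_inj R)) oppr_eq0.
rewrite psumr_eq0 => [|i _]; last by rewrite subr_ge0 ler_norm.
apply/allP/idP => [h|/set_mem[_ T] i _].
  apply/mem_set; split => // i; have := h i (mem_index_enum i).
  by rewrite /= subr_eq0 => /eqP <-.
by rewrite /= ger0_norm ?subrr//; exact: T.
Qed.

Lemma continuous_cell_cut w : continuous (cell_cut w).
Proof.
move=> p; have c i : (fun q : plane R => bary i (Fwinv w q)) @ p --> bary i (Fwinv w p).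
  apply: (@continuous_comp _ _ _ (Fwinv w) (bary i)); first exact: continuous_Fwinv.
  exact: continuous_bary.
have c' i : (fun q : plane R => `|bary i (Fwinv w q)| - bary i (Fwinv w q)) @ p
    --> `|bary i (Fwinv w p)| - bary i (Fwinv w p).
  by apply: cvgB => //; exact: cvg_norm.
apply: (@continuous_comp _ _ _
  (fun q => - \sum_i (`|bary i (Fwinv w q)| - bary i (Fwinv w q))) (@expR R)).
  apply: cvgN; rewrite big_ord3; under eq_fun do rewrite big_ord3.
  by apply: cvgD; [exact: c'|apply: cvgD; exact: c'].
exact: continuous_expR.
Qed.

Lemma measurable_cell_cut w : measurable_fun [set: plane R] (cell_cut w).
Proof.
apply: measurableT_comp; first exact: measurable_expR.
have m i : measurable_fun [set: plane R] (fun q : plane R => bary i (Fwinv w q)).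
  apply: measurableT_comp; first exact: measurable_bary.
  exact: measurable_Fwinv.
apply: measurableT_comp => //; apply: measurable_sum => i.
by apply: measurable_funB => //; exact: measurableT_comp.
Qed.

Lemma bb_cell_cutX w n : bb (fun p => cell_cut w p ^+ n).
Proof.
split; first by apply: measurable_funTS; apply: measurable_funX; exact: measurable_cell_cut.
exists 1 => p _; rewrite normrX ger0_norm ?cell_cut_ge0//.
by rewrite exprn_ile1 ?cell_cut_ge0 ?cell_cut_le1.
Qed.

Lemma within_cell_cutX w n : {within K, continuous (fun p => cell_cut w p ^+ n)}.
Proof.
apply: continuous_subspaceT => p.
change (cell_cut w q ^+ n @[q --> p] --> cell_cut w p ^+ n).
elim: n => [|n IH]; first by under eq_fun do rewrite expr0; exact: cvg_cst.
rewrite exprS; under eq_fun do rewrite exprS.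
by apply: cvgM => //; exact: continuous_cell_cut.
Qed.

Lemma cell_cutX_cvg w p : K p ->
  cell_cut w p ^+ n @[n --> \oo] --> (\1_(cell K w) p : R).
Proof.
move=> Kp; rewrite indicE -cell_cut1//; case: eqP => [->|/eqP c1].
  by under eq_fun do rewrite expr1n; exact: cvg_cst.
apply: cvg_expr; rewrite ger0_norm ?cell_cut_ge0//.
by rewrite lt_neqAle c1 cell_cut_le1.
Qed.

(** Isolates the two operator identities so that they can be carried from continuous functions to
    cells by weak limits, and from cells to junction points by products. *)
Definition multiplicative phi := [/\ bb phi,
  forall psi x, bb psi -> act phi (act psi x) = act (phi \* psi) x &
  forall x y, dot (act phi x) y = dot x (act phi y)].

Lemma multiplicative_cell w : multiplicative \1_(cell K w).
Proof.
have bc : bb \1_(cell K w) by apply: bb_indic; exact: measurable_cell.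
have le1 n p : K p -> `|cell_cut w p ^+ n| <= 1.
  move=> _; rewrite normrX ger0_norm ?cell_cut_ge0//.
  by rewrite exprn_ile1 ?cell_cut_ge0 ?cell_cut_le1.
have lim x y : dot (act (fun p => cell_cut w p ^+ n) x) y @[n --> \oo]
    --> dot (act \1_(cell K w) x) y.
  apply: act_weak_cvg le1 => // [n|p]; first by have [] := bb_cell_cutX w n.
  exact: cell_cutX_cvg.
split => // [psi x b|x y].
  apply: dot_inj_symb => f u cf du.
  have [m [M bM]] := b.
  have l2 : dot (act ((fun p => cell_cut w p ^+ n) \* psi) x) (symb f u) @[n --> \oo]
      --> dot (act (\1_(cell K w) \* psi) x) (symb f u).
    apply: (@act_weak_cvg _ _ (1 * M)) => [n||p Kp|n p Kp].
    - by apply: measurable_funM => //; have [] := bb_cell_cutX w n.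
    - exact: bbM.
    - by apply: cvgM; [exact: cell_cutX_cvg|exact: cvg_cst].
    - by rewrite normrM ler_pM//; [exact: le1|exact: bM].
  apply: cvgn_eq l2; rewrite (_ : (fun n => _) =
      (fun n => dot (act (fun p => cell_cut w p ^+ n) (act psi x)) (symb f u))).
    exact: lim.
  apply/funext => n; rewrite act_cont_mul//; first exact: bb_cell_cutX.
  exact: within_cell_cutX.
have := lim y x; rewrite dotC (_ : (fun n => _) =
    (fun n => dot (act (fun p => cell_cut w p ^+ n) x) y)).
  by move=> /cvgn_eq h; apply/esym/h; exact: lim.
apply/funext => n; rewrite act_cont_adj//; first by rewrite dotC.
  exact: bb_cell_cutX.
exact: within_cell_cutX.
Qed.

Lemma multiplicativeM phi psi : multiplicative phi -> multiplicative psi ->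
  multiplicative (phi \* psi).
Proof.
move=> [b1 m1 s1] [b2 m2 s2]; split; first exact: bbM.
  move=> chi x b; rewrite -m1// m2// m1; last exact: bbM.
  by apply: act_eq; [apply: bbM => //; exact: bbM|apply: bbM => //; exact: bbM|
    move=> p _ /=; rewrite mulrA].
move=> x y; rewrite -m1// s1 s2 m2//.
by congr (dot x _); apply: act_eq; [exact: bbM|exact: bbM|move=> p _ /=; rewrite mulrC].
Qed.

Lemma indicM_junction c i j : i != j ->
  \1_(cell K (rcons c i)) \* \1_(cell K (rcons c j)) =
  \1_[set Fw c (F1 i (vtx j))] :> (plane R -> R).
Proof. by move=> ij; rewrite -(junctionE hK c ij) indicI. Qed.

Lemma measurable_junction c i j : i != j -> measurable [set Fw c (F1 i (vtx j)) : plane R].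
Proof. by move=> ij; rewrite -(junctionE hK c ij); apply: measurableI; exact: measurable_cell. Qed.

Lemma multiplicative_junction c i j : i != j ->
  multiplicative \1_[set Fw c (F1 i (vtx j)) : plane R].
Proof. by move=> ij; rewrite -indicM_junction//; apply: multiplicativeM; exact: multiplicative_cell. Qed.

Lemma K_junction c i j : K (Fw c (F1 i (vtx j))).
Proof. by apply: attractor_Fw => //; apply: attractor_F1 => //; exact: attractor_vtx. Qed.

Notation E := (energy K).
Notation partial := (partial symb).

Let c1 : {within K, continuous (cst 1 : plane R -> R)}.
Proof. by apply: continuous_subspaceT => x; exact: cvg_cst. Qed.

Lemma dot_act_indic A u v : measurable A -> dom K u -> dom K v ->
  dot (act \1_A (partial u)) (partial v) = fine (nu u v (A `&` K)).
Proof.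
move=> mA du dv; rewrite (act_sym hact)//; last exact: bb_indic.
by rewrite -cintegral_indic//; apply: eq_cintegral => p _ /=; rewrite !mulr1.
Qed.

Lemma fine_nu_cell w u v : dom K u -> dom K v ->
  fine (nu u v (cell K w)) = rfac ^- size w * E (u \o Fw w) (v \o Fw w).
Proof. by move=> du dv; have [_ ->] := hnu du dv. Qed.

(* Junction points carry no energy: their masses are nonnegative and, by
   inclusion-exclusion and self-similarity, add up to [0]. *)
Lemma act_junction_partial c i j u : i != j -> dom K u ->
  act \1_[set Fw c (F1 i (vtx j))] (partial u) = 0.
Proof.
move=> ij du.
(* Multiplication by the indicator is a self-adjoint projection, so the mass of the point is a
   squared norm. *)
have norm k l : k != l -> fine (nu u u [set Fw c (F1 k (vtx l))]) =
    dot (act \1_[set Fw c (F1 k (vtx l))] (partial u))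
        (act \1_[set Fw c (F1 k (vtx l))] (partial u)).
  move=> kl; have [b m s] := multiplicative_junction c kl.
  rewrite -s m// -indicI setIid dot_act_indic//; last exact: measurable_junction.
  by rewrite setIidl// => _ ->; exact: K_junction.
have ge0 k l : k != l -> 0 <= fine (nu u u [set Fw c (F1 k (vtx l))]).
  by move=> kl; rewrite norm// dnorm sqr_ge0.
have nxt (k : 'I_3) : k != k + 1 by move: k; apply: ord3P.
(* By [energy_split] the cell has the total mass of its subcells, so the correction term of
   [fine_charge_cell] is 0. *)
have sum0 : \sum_k fine (nu u u [set Fw c (F1 k (vtx (k + 1)))]) = 0.
  have := fine_charge_cell (nu u u) c hK; rewrite fine_nu_cell//.
  rewrite (energy_split hK (dom_Fw hK c du) (dom_Fw hK c du)).
  rewrite [X in _ = X - _](_ : _ =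
    rfac ^- size c * (rfac^-1 * \sum_i E (u \o Fw c \o F1 i) (u \o Fw c \o F1 i))).
    by lra.
  rewrite !mulr_sumr; apply: eq_bigr => i' _.
  rewrite fine_nu_cell// size_rcons exprSr invfM -cats1 Fw_cat.
  by rewrite mulrA [_ * rfac^-1]mulrC.
have all0 k : fine (nu u u [set Fw c (F1 k (vtx (k + 1)))]) = 0.
  move/eqP: sum0; rewrite psumr_eq0 => [|k' _]; last exact: ge0.
  by move/allP/(_ k (mem_index_enum k))/eqP.
suff z : fine (nu u u [set Fw c (F1 i (vtx j))]) = 0.
  by apply: (dot_eq0 dnorm); rewrite -norm.
(* Distinct indices modulo 3 are neighbours in one of the two orders, and both orders name the same
   junction point. *)
have : j = i + 1 \/ i = j + 1.
  by move: i j ij {norm}; apply: ord3P; apply: ord3P => //= _;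
    rewrite ?ord3_add; (by left) || (by right).
by move=> [->//|->]; rewrite F1_vtxC.
Qed.

(** On symbols the integrand lives at a single point, so the continuous factors become the constant
    [f p * g p] and the case of [partial u] applies; density does the rest. *)
Lemma act_junction c i j x : i != j -> act \1_[set Fw c (F1 i (vtx j))] x = 0.
Proof.
move=> ij; have [b m s] := multiplicative_junction c ij.
apply: (@symb_dense_ind (fun x => act \1_[set Fw c (F1 i (vtx j))] x = 0)).
- apply: (@closed_eqH H _ (fun=> 0)); first exact: (act_continuous hact b).
  by move=> y; exact: cvg_cst.
- exact: act0r.
- by move=> y z e1 e2; rewrite actD// e1 e2 addr0.
move=> f u cf du; apply: dot_eq0_symb => g v cg dv.
rewrite (act_sym hact)//.
set p := Fw c (F1 i (vtx j)).
have mp : measurable [set p] by exact: measurable_junction.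
rewrite (@eq_cintegral _ _ _ _ (fun q => f p * g p * \1_[set p] q)); last first.
  move=> q _ /=; rewrite indicE; have [qp|qp] := boolP (q \in [set p]).
    by move: qp; rewrite inE => ->; rewrite mul1r mulr1.
  by rewrite !mul0r mulr0.
rewrite cintegral_indicZ// -dot_act_indic// act_junction_partial//.
by rewrite dot0l mulr0.
Qed.

Lemma act_set0 x : act \1_set0 x = 0.
Proof.
have b : bb \1_(set0 : set (plane R)) by exact: bb_indic.
apply: dot_eq0_symb => f u cf du.
by have [_ <-//] := hnuH x (symb f u); rewrite cintegral_indic// set0I charge0.
Qed.

Lemma act_cellC (v w : word) x : act \1_(cell K v) (act \1_(cell K w) x) =
  act \1_(cell K v `&` cell K w) x.
Proof.
have [_ m _] := multiplicative_cell v; have [b _ _] := multiplicative_cell w.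
by rewrite m// indicI.
Qed.

Lemma act_cell_prefix (v w : word) x : prefix v w ->
  act \1_(cell K v) (act \1_(cell K w) x) = act \1_(cell K w) x.
Proof. by move=> /(cell_prefix hK) vw; rewrite act_cellC setIidr. Qed.

Lemma act_cell_incomp (v w : word) x : ~~ prefix v w -> ~~ prefix w v ->
  act \1_(cell K v) (act \1_(cell K w) x) = 0.
Proof.
move=> vw wv; rewrite act_cellC.
have [c [i [j [ij /subset_set1[->|->]]]]] := cell_meet hK vw wv.
  exact: act_set0.
exact: act_junction.
Qed.

Lemma act_attractor x : act \1_K x = x.
Proof.
have b : bb \1_K by exact: bb_indic.
rewrite (act_eq _ b (bb_cst 1)) => [|p Kp]; last by rewrite indicE mem_set.
apply: dot_inj_symb => f u cf du.
have bc := bb_cst 1.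
rewrite act_cont_adj// act_symb//; congr (dot _ (symb _ _)).
by apply/funext => p /=; rewrite mul1r.
Qed.

Notation Q w u := (act \1_(cell K w) (partial u)).

Lemma dot_Q_partial w u v : dom K u -> dom K v ->
  dot (Q w u) (partial v) = rfac ^- size w * E (u \o Fw w) (v \o Fw w).
Proof.
move=> du dv; rewrite dot_act_indic//; last exact: measurable_cell.
by rewrite setIidl ?fine_nu_cell//; exact: (cell_sub hK).
Qed.

Lemma dot_Q (w v : word) u u' : dom K u -> dom K u' -> dot (Q (w ++ v) u) (Q w u') =
  rfac ^- size (w ++ v) * E (u \o Fw (w ++ v)) (u' \o Fw (w ++ v)).
Proof.
move=> du du'; have [_ _ s] := multiplicative_cell w.
by rewrite -s act_cell_prefix ?prefix_prefix// dot_Q_partial.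
Qed.

Lemma dot_Q_incomp (w v : word) u u' : ~~ prefix v w -> ~~ prefix w v ->
  dot (Q w u) (Q v u') = 0.
Proof.
move=> vw wv; have [_ _ s] := multiplicative_cell v.
by rewrite -s act_cell_incomp// dot0l.
Qed.

(** The squared norm of the difference expands into energies that see only the cell [w], where the
    functions agree. This makes forms on a cell independent of the chosen extension. *)
Lemma Q_ext w u u' : dom K u -> dom K u' ->
  (forall p, K p -> u (Fw w p) = u' (Fw w p)) -> Q w u = Q w u'.
Proof.
move=> du du' e; apply/eqP; rewrite -subr_eq0; apply/eqP/(dot_eq0 dnorm).
have D a b : dom K a -> dom K b -> dot (Q w a) (Q w b) =
    rfac ^- size w * E (a \o Fw w) (b \o Fw w).
  by move=> da db; have := dot_Q w [::] da db; rewrite cats0.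
rewrite dotDl !dotDr !dotNl !dotNr !D//.
rewrite !(@energy_ext _ _ hK (u' \o Fw w) _ (u \o Fw w) (u \o Fw w))//;
  try by move=> x Kx /=; rewrite e.
rewrite (@energy_ext _ _ hK (u \o Fw w) (u' \o Fw w) (u \o Fw w) (u \o Fw w))//.
  by ring.
by move=> x Kx /=; rewrite e.
Qed.

(** * Forms supported in one cell, and pull-back by levels *)

Section Pieces.
Variables (psi : word -> plane R -> R) (hpsi : psi_spec K psi).
Implicit Types (a b s t : word).

Let h i := psi [:: i] \o F1 i.

Let h_harm i : harmonic_fun K (h i). Proof. by have [_ /(_ i)[]] := hpsi. Qed.

Let h0 i : h i (vtx i) = 0.
Proof. by have [_ /(_ i)[_ ? _ _]] := hpsi; rewrite /h /= F1_vtx. Qed.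

Let h1 i : h i (vtx (i + 1)) = 1. Proof. by have [_ /(_ i)[]] := hpsi. Qed.

Let h2 i : h i (vtx (i + 2)) = -1. Proof. by have [_ /(_ i)[]] := hpsi. Qed.

(** By [extension_ex] an extension exists, so the default value in [extension] does not occur
    here. *)
Lemma extension_spec w f : dom K (f \o Fw w) -> dom K (extension K (cell K w) f) /\
  forall p, K p -> extension K (cell K w) f (Fw w p) = f (Fw w p).
Proof.
move=> df; have [v dv vE] := extension_ex hK h_harm h0 h1 h2 w df.
have : [set v | dom K v /\ {in cell K w, v =1 f}] (extension K (cell K w) f).
  apply: xgetPex; exists v; split => // q; rewrite inE => -[p Kp <-]; exact: vE.
by move=> [d e]; split => // p Kp; apply: e; rewrite inE; exists p.
Qed.

Definition piece w g := Q w (extension K (cell K w) (g \o Fwinv w)).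

Lemma piece_spec w g : dom K g -> exists2 u, dom K u &
  piece w g = Q w u /\ forall p, K p -> u (Fw w p) = g p.
Proof.
move=> dg; have e : (g \o Fwinv w) \o Fw w = g.
  by apply/funext => p /=; rewrite FwK.
have := @extension_spec w (g \o Fwinv w); rewrite e => /(_ dg)[du ue].
by exists (extension K (cell K w) (g \o Fwinv w)) => //; split => // p Kp; rewrite ue//= FwK.
Qed.

Lemma Q_piece w u : dom K u -> Q w u = piece w (u \o Fw w).
Proof.
move=> du; have [u' du' [-> e]] := piece_spec w (dom_Fw hK w du).
by apply: Q_ext => // p Kp; rewrite e.
Qed.

Lemma partial_piece u : dom K u -> partial u = piece [::] u.
Proof. by move=> du; rewrite -(Q_piece [::] du) cell_nil act_attractor. Qed.

Lemma dot_piece (w v : word) g g' : dom K g -> dom K g' -> dot (piece (w ++ v) g) (piece w g') =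
  rfac ^- size (w ++ v) * E g (g' \o Fw v).
Proof.
move=> /(piece_spec (w ++ v))[u du [-> ue]] /(piece_spec w)[u' du' [-> ue']].
rewrite dot_Q//; congr (_ * _); apply: (energy_ext hK) => p Kp /=; first exact: ue.
by rewrite Fw_cat /= ue'//; exact: attractor_Fw.
Qed.

Lemma dot_piece_same w g g' : dom K g -> dom K g' ->
  dot (piece w g) (piece w g') = rfac ^- size w * E g g'.
Proof. by move=> dg dg'; have := dot_piece w [::] dg dg'; rewrite cats0. Qed.

Lemma dot_piece_incomp (w v : word) g g' : dom K g -> dom K g' ->
  ~~ prefix v w -> ~~ prefix w v -> dot (piece w g) (piece v g') = 0.
Proof.
move=> /(piece_spec w)[u du [-> _]] /(piece_spec v)[u' du' [-> _]]; exact: dot_Q_incomp.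
Qed.

Lemma piece_lin w c g g' : dom K g -> dom K g' ->
  piece w (fun p => c * g p + g' p) = c *: piece w g + piece w g'.
Proof.
move=> dg dg'; have dl := dom_lin hK c dg dg'.
apply/eqP; rewrite -subr_eq0; apply/eqP; set z := _ - _.
have hz g2 : dom K g2 -> dot z (piece w g2) = 0.
  move=> d2; rewrite /z dotDl dotNl dotDl dotZl !dot_piece_same// energyDl//; ring.
apply: (dot_eq0 dnorm); rewrite {2}/z dotDr dotNr dotDr dotZr !hz//.
by rewrite mulr0; lra.
Qed.

(** The difference [z] of the two sides is orthogonal to every piece on [w] and to every piece on a
    subcell of [w]. Being itself a combination of such pieces, it is orthogonal to itself. *)
Lemma piece_split w g : dom K g ->
  piece w g = \sum_i piece (rcons w i) (g \o F1 i).
Proof.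
move=> dg; apply/eqP; rewrite -subr_eq0; apply/eqP; set z := _ - _.
have incomp (i j : 'I_3) : i != j -> ~~ prefix (rcons w i) (rcons w j).
  by move=> ij; rewrite -!cats1 prefix_catr// eqxx prefix_cons (negbTE ij).
have hz g2 : dom K g2 -> dot z (piece w g2) = 0.
  move=> d2; rewrite /z dotDl dotNl dot_suml dot_piece_same// (energy_split hK dg d2).
  rewrite mulrA mulr_sumr -sumrB; apply: big1 => i _.
  rewrite -cats1 dot_piece//; last exact: dom_F1.
  have -> : rfac ^- size (w ++ [:: i]) = rfac ^- size w * rfac^-1 :> R.
    by rewrite size_cat addn1 exprSr invfM mulrC.
  exact: subrr.
have hzi j g2 : dom K g2 -> dot z (piece (rcons w j) g2) = 0.
  move=> d2; rewrite /z dotDl dotNl dot_suml (bigD1 j)//= big1 => [|i ij]; last first.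
    by apply: dot_piece_incomp; rewrite ?incomp// ?[j == i]eq_sym//; exact: dom_F1.
  rewrite addr0 dot_piece_same//; last exact: dom_F1.
  rewrite dotC -cats1 dot_piece// energyC//; last exact: dom_F1.
  by rewrite subrr.
apply: (dot_eq0 dnorm); rewrite {2}/z dotDr dotNr dot_sumr hz// big1 ?oppr0 ?addr0//.
by move=> i _; apply: hzi; exact: dom_F1.
Qed.

Lemma piece_words w n g : dom K g ->
  piece w g = \sum_(s <- words n) piece (w ++ s) (g \o Fw s).
Proof.
elim: n w g => [|n IH] w g dg; first by rewrite /= big_seq1 cats0.
rewrite big_words_cons piece_split//; apply: eq_bigr => i _.
by rewrite IH; [apply: eq_bigr => s _; rewrite cat_rcons|exact: dom_F1].
Qed.

Lemma act_piece_prefix (v w : word) g : prefix v w ->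
  act \1_(cell K v) (piece w g) = piece w g.
Proof. exact: act_cell_prefix. Qed.

Lemma act_piece_incomp (v w : word) g : ~~ prefix v w -> ~~ prefix w v ->
  act \1_(cell K v) (piece w g) = 0.
Proof. exact: act_cell_incomp. Qed.

Lemma piece_cst0 w : piece w (cst 0) = 0.
Proof.
apply: (dot_eq0 dnorm); rewrite dot_piece_same ?energy_cst ?mulr0//; exact: dom_cst.
Qed.

Definition level n (g : word -> plane R -> R) := \sum_(b <- words n) piece b (g b).

Definition dom_level n (g : word -> plane R -> R) := forall b, size b = n -> dom K (g b).

Lemma eq_level n (g g' : word -> plane R -> R) : (forall b, size b = n -> g b = g' b) -> level n g = level n g'.
Proof.
move=> e; rewrite /level big_seq [RHS]big_seq; apply: eq_bigr => b.
by rewrite mem_words => /eqP/e ->.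
Qed.

Lemma level_lin n c (g g' : word -> plane R -> R) : dom_level n g -> dom_level n g' ->
  level n (fun b p => c * g b p + g' b p) = c *: level n g + level n g'.
Proof.
move=> dg dg'; rewrite /level scaler_sumr -big_split /= big_seq [RHS]big_seq.
apply: eq_bigr => b; rewrite mem_words => /eqP bn.
by rewrite piece_lin//; [exact: dg|exact: dg'].
Qed.

Lemma level_refine n m (g : word -> plane R -> R) : dom_level n g ->
  level n g = level (n + m) (fun b => g (take n b) \o Fw (drop n b)).
Proof.
move=> dg; rewrite /level big_words_cat big_seq [RHS]big_seq.
apply: eq_bigr => b; rewrite mem_words => /eqP bn.
rewrite (piece_words _ m (dg _ bn)); apply: eq_bigr => s _.
by rewrite -bn take_size_cat// drop_size_cat.
Qed.

Lemma dom_level_refine n m (g : word -> plane R -> R) : dom_level n g ->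
  dom_level (n + m) (fun b => g (take n b) \o Fw (drop n b)).
Proof.
move=> dg b bnm; apply: dom_Fw => //; apply: dg.
by rewrite size_takel// bnm leq_addr.
Qed.

Lemma act_level n (v : word) (g : word -> plane R -> R) : (size v <= n)%N ->
  act \1_(cell K v) (level n g) = \sum_(b <- words n | prefix v b) piece b (g b).
Proof.
move=> vn; have [bc _ _] := multiplicative_cell v.
rewrite /level act_sum// [RHS]big_mkcond big_seq [RHS]big_seq.
apply: eq_bigr => b; rewrite mem_words => /eqP bn.
case: ifPn => vb; first exact: act_piece_prefix.
apply: act_piece_incomp => //; apply: contra vb => /prefixP[s vE].
move: vn; rewrite vE size_cat bn -[X in (_ <= X)%N]addn0 leq_add2l leqn0 size_eq0.
by move=> /eqP ->; rewrite cats0 prefix_refl.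
Qed.

Lemma dot_level n (P : pred word) (g g' : word -> plane R -> R) : dom_level n g -> dom_level n g' ->
  dot (\sum_(b <- words n | P b) piece b (g b)) (level n g') =
  \sum_(b <- words n | P b) rfac ^- n * E (g b) (g' b).
Proof.
move=> dg dg'; rewrite dot_suml big_seq_cond [RHS]big_seq_cond.
apply: eq_bigr => b /andP[bn _]; move: (bn); rewrite mem_words => /eqP bnE.
rewrite /level dot_sumr (bigD1_seq b bn (words_uniq n))/=.
rewrite dot_piece_same; [|exact: dg|exact: dg']; rewrite bnE big_seq_cond big1 ?addr0//.
move=> s /andP[]; rewrite mem_words => /eqP sn sb.
have nopre (s1 s2 : word) : size s1 = n -> size s2 = n -> s1 != s2 -> ~~ prefix s1 s2.
  move=> e1 e2; apply: contraNN => /prefixP[t tE].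
  have : size t == 0%N.
    by rewrite -(eqn_add2l (size s1)) -size_cat -tE e1 e2 addn0.
  by rewrite size_eq0 => /eqP t0; rewrite tE t0 cats0.
apply: dot_piece_incomp; [exact: dg|exact: dg'|exact: nopre|].
by apply: nopre => //; rewrite eq_sym.
Qed.

(* [pulls w x y]: on some level, the pieces of [y] are the pieces of [x] inside
   the cell [w]; thus [y] is the pull-back of [x] by [Fw w]. *)
Definition pulls w x y := exists n (g : word -> plane R -> R), [/\ dom_level (size w + n) g,
  x = level (size w + n) g & y = level n (fun s => g (w ++ s))].

Lemma dom_level_cat w n (g : word -> plane R -> R) : dom_level (size w + n) g ->
  dom_level n (fun s => g (w ++ s)).
Proof. by move=> dg s sn; apply: dg; rewrite size_cat sn. Qed.

(** Splitting pieces carries a representation to every finer level, so two pull-backs can be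
    compared on a common one. *)
Lemma pulls_refine w x y : pulls w x y -> exists n0, forall n, (n0 <= n)%N ->
  exists g : word -> plane R -> R, [/\ dom_level (size w + n) g,
    x = level (size w + n) g & y = level n (fun s => g (w ++ s))].
Proof.
move=> [n0 [g [dg -> ->]]]; exists n0 => n nn.
rewrite -(subnKC nn); set m := (n - n0)%N.
exists (fun b => g (take (size w + n0) b) \o Fw (drop (size w + n0) b)).
rewrite addnA; split; [exact: dom_level_refine|exact: level_refine|].
rewrite (level_refine m (dom_level_cat dg)); apply: eq_level => s sn.
by rewrite take_cat drop_cat ltnNge leq_addr /= addKn.
Qed.

Lemma pulls_common w x y x' y' : pulls w x y -> pulls w x' y' ->
  forall m, exists n (g g' : word -> plane R -> R), [/\ (m <= n)%N, dom_level (size w + n) g,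
    dom_level (size w + n) g', x = level (size w + n) g /\ y = level n (fun s => g (w ++ s)) &
    x' = level (size w + n) g' /\ y' = level n (fun s => g' (w ++ s))].
Proof.
move=> /pulls_refine[n1 h1'] /pulls_refine[n2 h2'] m.
pose n := maxn m (maxn n1 n2).
have [|g [dg xE yE]] := h1' n; first by rewrite leq_max orbC leq_max leqnn.
have [|g' [dg' xE' yE']] := h2' n; first by rewrite leq_max orbC leq_max leqnn orbT.
by exists n, g, g'; split => //; rewrite leq_maxl.
Qed.

Lemma pulls_lin w c x y x' y' : pulls w x y -> pulls w x' y' ->
  pulls w (c *: x + x') (c *: y + y').
Proof.
move=> p p'; have [n [g [g' [_ dg dg' [-> ->] [-> ->]]]]] := pulls_common p p' 0.
exists n, (fun b p => c * g b p + g' b p); split.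
- by move=> b bn; apply: dom_lin => //; [exact: dg|exact: dg'].
- by rewrite level_lin.
- by rewrite (@level_lin n c (fun s => g (w ++ s)) (fun s => g' (w ++ s)))//;
    exact: dom_level_cat.
Qed.

(** On a common level both inner products are diagonal. The words extending [w ++ v] are the
    [w ++ s] with [s] extending [v], and the factor comes from the difference [size w] of their
    lengths. *)
Lemma pulls_dot (w v : word) x y x' y' : pulls w x y -> pulls w x' y' ->
  dot (act \1_(cell K (w ++ v)) x) x' =
  rfac ^- size w * dot (act \1_(cell K v) y) y'.
Proof.
move=> p p'; have [n [g [g' [vn dg dg' [-> ->] [-> ->]]]]] := pulls_common p p' (size v).
rewrite act_level; last by rewrite size_cat leq_add2l.
rewrite act_level// dot_level// dot_level; try exact: dom_level_cat.
have e b : prefix (w ++ v) b = prefix w b && prefix (w ++ v) b.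
  by case: prefixP => [[s ->]|_]; rewrite ?andbT ?andbF// -catA prefix_prefix.
under eq_bigl do rewrite e.
rewrite big_words_prefix mulr_sumr; apply: eq_big => [s|s _].
  by rewrite prefix_catr// eqxx.
by rewrite exprD invfM -mulrA.
Qed.

(** * The basis forms of the coexact part and their pull-backs *)

Lemma psi_at_cat a i : psi_at psi a (a ++ [:: i]) \o Fw (a ++ [:: i]) = h i.
Proof.
by rewrite /psi_at prefix_prefix drop_size_cat// Fw_cat; apply/funext => p /=; rewrite FwK.
Qed.

Lemma psi_at_dom a t : size t = (size a).+1 -> dom K (psi_at psi a t \o Fw t).
Proof.
have [/prefixP[s ->]|at_] := boolP (prefix a t); last first.
  by move=> _; rewrite /psi_at (negbTE at_); exact: (dom_cst hK 0).
rewrite size_cat => as1; have {as1} : size s = 1%N.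
  by apply: (@addnI (size a)); rewrite as1 addn1.
case: s => [|i [|//]]// _.
by rewrite psi_at_cat; case: (h_harm i).
Qed.

Lemma pw_d_level m (u : word -> plane R -> R) :
  pw_d K symb act (Posz m.+1) u = level m.+1 (fun b => u b \o Fw b).
Proof.
rewrite /pw_d (big_tuple_words m.+1
  (fun b => act \1_(cell K b) (partial (extension K (cell K b) (u b))))).
apply: eq_bigr => b _; rewrite /piece; congr (act _ (partial (extension _ _ _))).
by apply/funext => p /=; rewrite FwinvK.
Qed.

Lemma d_psi_level a :
  d_psi K symb act psi a = level (size a).+1 (fun b => psi_at psi a b \o Fw b).
Proof. by rewrite /d_psi -PoszD addn1 pw_d_level. Qed.

(* The piece of [psi_at psi a] on a cell [b] of level at least [|a| + 1]. *)
Definition psi_piece a b := psi_at psi a (take (size a).+1 b) \o Fw b.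

Lemma psi_piece_dom a b : (size a < size b)%N -> dom K (psi_piece a b).
Proof.
move=> ab; rewrite /psi_piece -{2}(cat_take_drop (size a).+1 b) Fw_cat.
by rewrite compA; apply: dom_Fw => //; apply: psi_at_dom; rewrite size_takel.
Qed.

Lemma d_psi_level_ge a n : d_psi K symb act psi a =
  level ((size a).+1 + n) (psi_piece a).
Proof.
rewrite d_psi_level (@level_refine _ n) => [|b]; last exact: psi_at_dom.
apply: eq_level => b _; rewrite /psi_piece.
by rewrite -compA -Fw_cat cat_take_drop.
Qed.

Lemma pulls_partial w u : dom K u -> pulls w (partial u) (partial (u \o Fw w)).
Proof.
move=> du; exists 0, (fun b => u \o Fw b); rewrite addn0; split.
- by move=> b _; exact: dom_Fw.
- by rewrite partial_piece// (piece_words _ (size w) du).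
- by rewrite /level /= big_seq1 cats0 partial_piece//; exact: dom_Fw.
Qed.

Lemma psi_comp_nil a w : (size a < size w)%N -> psi_comp psi a w [::] = psi_piece a w.
Proof.
move=> aw; rewrite /psi_comp /pw_comp /psi_piece; case: ifP => // wa.
by rewrite cats0 take_oversize.
Qed.

Lemma pw_d_le0 a w : (size a < size w)%N ->
  pw_d K symb act ((size a)%:Z - (size w)%:Z + 1) (psi_comp psi a w) =
  partial (psi_comp psi a w [::]).
Proof.
move=> aw; have : (size a)%:Z - (size w)%:Z + 1 <= 0.
  by rewrite -(subrK (size a)%:Z (size w)%:Z) subzn ?(ltnW aw)//; lia.
by case: (_ + 1) => [[|m]|m].
Qed.

(** If [a] is shorter than [w], the cell [w] lies in one cell of level [(size a).+1], and the
    pull-back is the differential of a single function, of level 0. Otherwise level [(size a).+1]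
    represents both forms. *)
Lemma pulls_psi w a : pulls w (d_psi K symb act psi a)
  (pw_d K symb act ((size a)%:Z - (size w)%:Z + 1) (psi_comp psi a w)).
Proof.
have [aw|wa] := ltnP (size a) (size w).
  rewrite pw_d_le0// psi_comp_nil//; exists 0, (psi_piece a); rewrite addn0; split.
  - by move=> b bw; apply: psi_piece_dom; rewrite bw.
  - by rewrite (d_psi_level_ge a (size w - (size a).+1)) subnKC.
  - by rewrite /level /= big_seq1 cats0 partial_piece//; exact: psi_piece_dom.
exists (size a - size w).+1, (psi_piece a).
have aE : (size w + (size a - size w).+1)%N = (size a).+1 by rewrite addnS subnKC.
rewrite aE; split.
- by move=> b bw; apply: psi_piece_dom; rewrite bw.
- by rewrite (d_psi_level_ge a 0) addn0.
rewrite subzn// -PoszD addn1 pw_d_level; apply: eq_level => s sn.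
rewrite /psi_comp /pw_comp (leqW wa) /psi_piece Fw_cat take_oversize//.
by rewrite size_cat sn aE.
Qed.

(** Only the three subcells of [a] contribute, all with the same scaling factor; what remains is the
    sum in [sum_energy_harmonic] for [u \o Fw a]. *)
Lemma d_psi_ker a : ker_dstar K dot symb (d_psi K symb act psi a).
Proof.
move=> u du; rewrite d_psi_level /level dot_suml (partial_piece du).
rewrite (eq_big_seq (fun b => rfac ^- (size a).+1 *
    E (psi_at psi a b \o Fw b) (u \o Fw b))) => [|b]; last first.
  rewrite mem_words => /eqP bn.
  by rewrite (@dot_piece [::] b)// ?bn//; exact: psi_at_dom.
rewrite -mulr_sumr -[X in words X]addn1; set W := words _.
rewrite (bigID (prefix a))/= [X in _ + X]big1 => [|b ab]; last first.
  by rewrite /psi_at (negbTE ab); exact: (energy_cst hK 0).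
rewrite addr0 (eq_bigl (fun b => prefix a b && xpredT b)) => [|b]; last by rewrite andbT.
rewrite big_words_prefix big_words_cons.
rewrite (eq_bigr (fun i => E (h i) (u \o Fw a \o F1 i))) => [|i _].
  by rewrite (sum_energy_harmonic hK h_harm h0 h1 h2 (dom_Fw hK a du)) mulr0.
by rewrite big_seq1 psi_at_cat Fw_cat.
Qed.

(** For a self-adjoint projection the squared norm of the image is its inner product with [x];
    Cauchy-Schwarz then allows one factor to be cancelled. *)
Lemma act_cell_le w x : `|act \1_(cell K w) x| <= `|x|.
Proof.
have [_ m s] := multiplicative_cell w; have := dot_le dnorm (act \1_(cell K w) x) x.
rewrite -{1}(act_cell_prefix x (prefix_refl w)) s dnorm.
have [->|n0] := eqVneq (`|act \1_(cell K w) x|) 0; first by [].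
by rewrite expr2 ler_pM2l// lt_neqAle eq_sym n0 normr_ge0.
Qed.

(** Scaling turns the squared norm of [y] into [rfac ^+ size w] times the inner product of
    [act \1_(cell K w) x] with [x], and [rfac] is at most 1. *)
Lemma pulls_norm w x y : pulls w x y -> `|y| <= `|x|.
Proof.
move=> p; have := pulls_dot [::] p p; rewrite cats0 cell_nil act_attractor dnorm.
have rw0 : 0 < rfac ^+ size w :> R by rewrite exprn_gt0// rfac_gt0.
move=> /(congr1 ( *%R (rfac ^+ size w))); rewrite mulrA divff ?gt_eqF// mul1r => e.
rewrite -(ler_sqr)// ?nnegrE// -e.
have le1 : rfac ^+ size w <= 1 :> R.
  by rewrite exprn_ile1 ?rfac_ge0// /rfac ler_pdivrMr// mul1r ler_nat.
have d := dot_le dnorm (act \1_(cell K w) x) x.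
have d2 := ler_wpM2r (normr_ge0 x) (act_cell_le w x).
apply: (@le_trans _ _ (rfac ^+ size w * `|x| ^+ 2)).
  by rewrite ler_wpM2l// ?(ltW rw0)// expr2; exact: le_trans d d2.
by rewrite ler_piMl// sqr_ge0.
Qed.

#[local] Existing Instance totally_filter.

Notation dpsi := (d_psi K symb act psi).

Lemma partial_lin c u v : dom K u -> dom K v ->
  partial (fun p => c * u p + v p) = c *: partial u + partial v.
Proof.
move=> du dv; have dl := dom_lin hK c du dv.
by rewrite (partial_piece dl) piece_lin// -!partial_piece.
Qed.

Lemma partial_cst0 : partial (cst 0) = 0.
Proof. by rewrite partial_piece ?piece_cst0//; exact: dom_cst. Qed.

Lemma dom_partial_sum (s : seq word) (c : word -> R) (f : word -> plane R -> R) u :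
  dom K u -> (forall a, a \in s -> dom K (f a)) ->
  dom K (fun p => u p + \sum_(a <- s) c a * f a p) /\
  partial (fun p => u p + \sum_(a <- s) c a * f a p) =
    partial u + \sum_(a <- s) c a *: partial (f a).
Proof.
move=> du; elim: s => [|a s IH] fs.
  rewrite big_nil addr0 (_ : (fun p => _) = u)//.
  by apply/funext => p; rewrite big_nil addr0.
have [|d e] := IH; first by move=> b bs; apply: fs; rewrite inE bs orbT.
have da : dom K (f a) by apply: fs; rewrite mem_head.
rewrite (_ : (fun p => _) = (fun p => c a * f a p +
    (u p + \sum_(b <- s) c b * f b p))); last first.
  by apply/funext => p; rewrite big_cons addrCA.
split; first exact: dom_lin.
by rewrite (partial_lin _ da d) e big_cons addrCA.
Qed.

Lemma pulls0 w : pulls w 0 0.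
Proof.
have := pulls_partial w (dom_cst hK 0).
by rewrite (_ : cst 0 \o Fw w = cst 0) ?partial_cst0.
Qed.

(** * Passage from finite sums to the full expansion *)

Lemma pulls_partial_sum w (c : word -> R) (A : {fset word}) :
  pulls w (partial_sum (fun a => c a *: dpsi a) A)
    (partial_sum (form_comp_term K symb act psi c w) A).
Proof.
rewrite /partial_sum; elim/big_rec2: _ => [|i y x _ p]; first exact: pulls0.
by apply: pulls_lin => //; exact: pulls_psi.
Qed.

Lemma pullsD w x y x' y' : pulls w x y -> pulls w x' y' -> pulls w (x + x') (y + y').
Proof. by move=> p p'; have := pulls_lin 1 p p'; rewrite !scale1r. Qed.

Lemma pullsB w x y x' y' : pulls w x y -> pulls w x' y' -> pulls w (x - x') (y - y').
Proof.
by move=> p p'; have := pulls_lin (-1) p' p; rewrite !scaleN1r !(addrC (- _)).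
Qed.

(** Differences of pulled-back partial sums are pull-backs of differences. The contraction
    [pulls_norm] therefore transfers the Cauchy property, and completeness gives the limit. *)
Lemma summable_form_comp_term w (c : word -> R) Theta :
  has_sum (fun a => c a *: dpsi a) Theta ->
  summable_in (form_comp_term K symb act psi c w).
Proof.
move=> sT; apply: cauchy_cvg; apply: cauchy_exP => e e0.
have e2 : 0 < e / 2 by rewrite divr_gt0.
have /cvgrPdist_lt/(_ _ e2)[A _ hA] := sT.
exists (partial_sum (form_comp_term K symb act psi c w) A); exists A => // B AB.
rewrite -ball_normE /=.
have p := pullsB (pulls_partial_sum w c A) (pulls_partial_sum w c B).
apply: le_lt_trans (pulls_norm p) _; rewrite [e]splitr.
have h1' := hA A (fsubset_refl A); have h2' := hA B AB.
rewrite -(subrK Theta (partial_sum _ A)) -addrA.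
by apply: le_lt_trans (ler_normD _ _) _; rewrite distrC ltrD.
Qed.

Lemma form_comp_cvg w om eta Theta (c : word -> R) :
  hodge K dot symb act psi om eta Theta c ->
  (fun A => partial eta + partial_sum (fun a => c a *: dpsi a) A) @ totally --> om /\
  (fun A => partial (eta \o Fw w) +
     partial_sum (form_comp_term K symb act psi c w) A) @ totally -->
    form_comp K symb act psi eta c w.
Proof.
move=> hd; have sT := hodge_sum hd; split.
  by rewrite (hodge_decomp hd); apply: cvgD => //; exact: cvg_cst.
apply: cvgD; first exact: cvg_cst.
exact: summable_form_comp_term sT.
Qed.

(** Both expansions are truncated to the same finite set of words, where [pulls_dot] applies; then
    the limit is taken on both sides. *)
Lemma dot_form_comp (w v : word) om om' eta eta' Theta Theta' (c c' : word -> R) :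
  hodge K dot symb act psi om eta Theta c ->
  hodge K dot symb act psi om' eta' Theta' c' ->
  dot (act \1_(cell K (w ++ v)) om) om' = rfac ^- size w *
    dot (act \1_(cell K v) (form_comp K symb act psi eta c w))
        (form_comp K symb act psi eta' c' w).
Proof.
move=> hd hd'.
have [x1 y1] := form_comp_cvg w hd; have [x2 y2] := form_comp_cvg w hd'.
have [b1 _ _] := multiplicative_cell (w ++ v); have [b2 _ _] := multiplicative_cell v.
have C phi (f : {fset word} -> H) x : bb phi -> f @ totally --> x ->
    (fun A => act phi (f A)) @ totally --> act phi x.
  by move=> b fx; apply: continuous_cvg fx; exact: (act_continuous hact b).
pose X (e : plane R -> R) (d : word -> R) (A : {fset word}) :=
  partial e + partial_sum (fun a => d a *: dpsi a) A.
pose Y (e : plane R -> R) (d : word -> R) (A : {fset word}) :=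
  partial (e \o Fw w) + partial_sum (form_comp_term K symb act psi d w) A.
have XY e d A : dom K e -> pulls w (X e d A) (Y e d A).
  by move=> de; apply: pullsD; [exact: pulls_partial|exact: pulls_partial_sum].
have key A : dot (act \1_(cell K (w ++ v)) (X eta c A)) (X eta' c' A) =
    rfac ^- size w * dot (act \1_(cell K v) (Y eta c A)) (Y eta' c' A).
  by apply: pulls_dot; apply: XY; [exact: hodge_dom hd|exact: hodge_dom hd'].
have l1 : (fun A => dot (act \1_(cell K (w ++ v)) (X eta c A)) (X eta' c' A)) @ totally
    --> dot (act \1_(cell K (w ++ v)) om) om'.
  by apply: (dot_cvg dnorm) => //; exact: C.
have l2 : (fun A => rfac ^- size w * dot (act \1_(cell K v) (Y eta c A)) (Y eta' c' A))
    @ totally --> rfac ^- size w *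
    dot (act \1_(cell K v) (form_comp K symb act psi eta c w))
        (form_comp K symb act psi eta' c' w).
  by apply: cvgM; [exact: cvg_cst|apply: (dot_cvg dnorm) => //; exact: C].
rewrite (funext key) in l1; exact: (@cvg_unique R (@Rhausdorff R) _ _ _ _ l1 l2).
Qed.

Lemma form_measure_cell w om om' :
  nuH om om' (cell K w) = (dot (act \1_(cell K w) om) om')%:E.
Proof.
have mc := measurable_cell hK w.
have [_ <-] := hnuH om om'; last exact: bb_indic.
by rewrite cintegral_indic// setIidl ?fineK ?fin_num_measure//; exact: cell_sub.
Qed.

Lemma form_measure_junction w i j om om' : i != j ->
  nuH om om' [set Fw w (F1 i (vtx j))] = 0%E.
Proof.
move=> ij; have mp := measurable_junction w ij.
have [_ /(_ _ (bb_indic mp))] := hnuH om om'.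
rewrite act_junction// dot0l cintegral_indic// setIidl; last first.
  by move=> _ ->; exact: K_junction.
by move=> e; rewrite -[LHS]fineK ?fin_num_measure// e.
Qed.

Lemma form_measure_pull w om om' eta eta' Theta Theta' (c c' : word -> R) :
  hodge K dot symb act psi om eta Theta c ->
  hodge K dot symb act psi om' eta' Theta' c' ->
  forall A, measurable A -> A `<=` K ->
  nuH om om' (Fw w @` A) = ((rfac ^- size w)%:E *
    nuH (form_comp K symb act psi eta c w) (form_comp K symb act psi eta' c' w) A)%E.
Proof.
move=> hd hd' A mA AK.
have FE (B : set (plane R)) : Fw w @` B = Fwinv w @^-1` B.
  apply/seteqP; split=> [_ [p Bp <-]|p Bp]; first by rewrite /preimage /= FwK.
  by exists (Fwinv w p) => //; rewrite FwinvK.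
(* The image of [A] under [Fw w] is its preimage under [Fwinv w], so the left side is a push-forward
   and hence a charge, comparable with [m2] by [charge_uniq]. *)
pose m1 := measure_function_pushforward__canonical__charge_Charge
  (nuH om om') (@measurable_Fwinv R w).
pose m2 : {charge set (plane R) -> \bar R} := cscale (rfac ^- size w)
  (nuH (form_comp K symb act psi eta c w) (form_comp K symb act psi eta' c' w)).
have := @charge_uniq R K m1 m2 hK; rewrite FE; apply => //.
- move=> v; change (nuH om om' (Fwinv w @^-1` cell K v) = m2 (cell K v)).
  by rewrite -FE -cell_cat form_measure_cell (dot_form_comp _ _ hd hd') EFinM -form_measure_cell.
- move=> v i j ij.
  change (nuH om om' (Fwinv w @^-1` [set Fw v (F1 i (vtx j))]) = 0%E).
  rewrite -FE image_set1 -[Fw w _]/((Fw w \o Fw v) _) -Fw_cat.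
  exact: form_measure_junction.
- by move=> v i j ij; rewrite /m2 /= /cscale form_measure_junction// mule0.
Qed.

(** * Splitting the pulled-back series along the prefix order *)

Definition strict_prefixes w : seq word := [seq take k w | k <- iota 0 (size w)].

Lemma strict_prefixesP a w : (a \in strict_prefixes w) = prefix a w && (size a < size w)%N.
Proof.
apply/mapP/andP => [[k + ->]|[/prefixP[s ->] aw]].
  rewrite mem_iota /= add0n => kw; rewrite size_takel ?(ltnW kw)//; split=> //.
  by rewrite -{2}(cat_take_drop k w) prefix_prefix.
exists (size a); last by rewrite take_size_cat.
by rewrite mem_iota.
Qed.

Lemma strict_prefixes_uniq w : uniq (strict_prefixes w).
Proof.
rewrite map_inj_in_uniq ?iota_uniq// => k l; rewrite !mem_iota /= !add0n => kw lw e.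
by rewrite -(size_takel (ltnW kw)) e size_takel// ltnW.
Qed.

Lemma strict_prefixes_cell w :
  [set a | cell K w `<` cell K a] = [set` strict_prefixes w].
Proof.
apply/seteqP; split=> a /=; rewrite strict_prefixesP.
  move=> [wa aw].
  have aw' := cell_subP hK wa; rewrite aw' ltnNge; apply/negP => sz.
  move: aw' aw wa => /prefixP[s wE]; move: sz; rewrite wE size_cat.
  rewrite -[X in (_ <= X)%N]addn0 leq_add2l leqn0 size_eq0 => /eqP ->.
  by rewrite cats0.
move=> /andP[aw sz]; split; first exact: (cell_prefix hK).
move=> /(cell_subP hK)/prefixP[s aE].
by move: sz; rewrite aE size_cat ltnNge leq_addr.
Qed.

Lemma exact_partE eta (c : word -> R) w : exact_part K psi eta c w =
  (fun p => (eta \o Fw w) p + \sum_(a <- strict_prefixes w) c a * psi_comp psi a w [::] p).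
Proof.
apply/funext => p; rewrite /exact_part /=; congr (_ + _).
rewrite [RHS]fsbig_seq; last exact: strict_prefixes_uniq.
by apply: eq_fsbigl; rewrite strict_prefixes_cell.
Qed.

Lemma psi_comp_dom a w : a \in strict_prefixes w -> dom K (psi_comp psi a w [::]).
Proof.
by rewrite strict_prefixesP => /andP[_ aw]; rewrite psi_comp_nil//; exact: psi_piece_dom.
Qed.

Lemma exact_part_spec eta (c : word -> R) w : dom K eta ->
  dom K (exact_part K psi eta c w) /\ partial (exact_part K psi eta c w) =
   partial (eta \o Fw w) +
   \sum_(a <- strict_prefixes w) form_comp_term K symb act psi c w a.
Proof.
move=> de; rewrite exact_partE.
have [d ->] := @dom_partial_sum (strict_prefixes w) c (fun a => psi_comp psi a w [::])
  (eta \o Fw w) (dom_Fw hK w de) (fun a => @psi_comp_dom a w).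
split => //; congr (_ + _); apply: eq_big_seq => a.
by rewrite strict_prefixesP /form_comp_term => /andP[_ aw]; rewrite pw_d_le0.
Qed.

(** Pulling back along [w] cancels the common prefix: the function attached to [w ++ s] becomes the
    one attached to [s]. *)
Lemma form_comp_term_cat (c : word -> R) w s :
  form_comp_term K symb act psi c w (w ++ s) = c (w ++ s) *: dpsi s.
Proof.
rewrite /form_comp_term /d_psi; congr (_ *: pw_d _ _ _ _ _).
  by rewrite size_cat PoszD [_ + _ - _]addrAC subrr add0r.
apply/funext => v; rewrite /psi_comp /pw_comp leqW ?size_cat ?leq_addr// /psi_at.
rewrite prefix_catr// eqxx /=; case: ifP => // sv.
rewrite Fwinv_cat; apply/funext => p /=; rewrite FwK.
by congr (psi _ _); rewrite ?size_cat addnC -drop_drop drop_size_cat.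
Qed.

Lemma pw_d0 n (u : word -> plane R -> R) : (forall b, u b = cst 0) ->
  pw_d K symb act n u = 0.
Proof.
move=> u0; case: n => [[|m]|m]; rewrite /pw_d ?u0 ?partial_cst0//.
have := pw_d_level m u; rewrite /pw_d => ->.
rewrite /level big1// => b _; rewrite u0; exact: piece_cst0.
Qed.

(** Every word at which [psi_comp] reads [psi_at psi a] is an extension or a prefix of [w]; if it
    began with [a], then [a] and [w] would be comparable. So only the zero branch is met. *)
Lemma form_comp_term_incomp (c : word -> R) w a : ~~ prefix a w -> ~~ prefix w a ->
  form_comp_term K symb act psi c w a = 0.
Proof.
move=> aw wa; rewrite /form_comp_term pw_d0 ?scaler0// => v.
rewrite /psi_comp /pw_comp /psi_at; case: ifP => wa'; case: ifP => //.
  move=> /prefixP[s e]; exfalso.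
  have [le|lt] := leqP (size a) (size w).
    by move: aw; rewrite prefixE -(takel_cat v le) e take_size_cat// eqxx.
  by move: wa; rewrite prefixE -(takel_cat s (ltnW lt)) -e take_size_cat// eqxx.
move=> /prefixP[s e]; exfalso; move/negP: aw; apply.
by apply/prefixP; exists (s ++ drop (size a).+1 w); rewrite catA -e cat_take_drop.
Qed.

Lemma partial_sum_seq (V : zmodType) (x : word -> V) (A : {fset word}) :
  partial_sum x A = \sum_(a <- A) x a.
Proof. by rewrite /partial_sum big_seq_fsetE. Qed.

(** Of the terms indexed by all words, those extending [w] form the shifted series, those at strict
    prefixes of [w] form the finite sum subtracted, and all others vanish. *)
Lemma form_comp_term_tail (c : word -> R) w L :
  has_sum (form_comp_term K symb act psi c w) L ->
  has_sum (fun s => c (w ++ s) *: dpsi s)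
    (L - \sum_(a <- strict_prefixes w) form_comp_term K symb act psi c w a).
Proof.
move=> sL; set f := form_comp_term K symb act psi c w; set Pf := \sum_(a <- _) _.
apply/cvgrPdist_lt => e e0; have /cvgrPdist_lt/(_ _ e0)[A _ hA] := sL.
(* Dropping [size w] letters recovers [s] from [w ++ s]; the images of the other elements of [A]
   only enlarge the set. *)
exists [fset drop (size w) a | a in A]%fset => // J /= AJ.
(* [B] contains [A], so its partial sum is close to [L]. Its words extending [w] are exactly the
   [w ++ s] with [s] in [J], and it contains all strict prefixes of [w]. *)
pose B := (A `|` ([fset w ++ s | s in J] `|` [fset a in strict_prefixes w]))%fset.
have AB : (A `<=` B)%fset by exact: fsubsetUl.
have := hA B AB; congr (`| _ | < _).
suff -> : partial_sum f B = partial_sum (fun s => c (w ++ s) *: dpsi s) J + Pf.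
  by rewrite opprD addrA addrAC.
rewrite !partial_sum_seq (bigID (prefix w))/=; congr (_ + _).
  rewrite -big_filter [RHS](eq_bigr (fun s => f (w ++ s))) => [|s _]; last first.
    by rewrite /f form_comp_term_cat.
  rewrite -(big_map (cat w) xpredT f); apply: perm_big; apply: uniq_perm.
  - by rewrite filter_uniq// fset_uniq.
  - by rewrite map_inj_uniq ?fset_uniq// => s t /eqP; rewrite eqseq_cat// eqxx => /eqP.
  move=> b; rewrite mem_filter !inE; apply/andP/mapP.
    move=> [/prefixP[s ->] /or3P[sA|/imfsetP[/= t tJ /eqP]|]].
    - exists s => //; apply: (fsubsetP AJ); apply/imfsetP; exists (w ++ s) => //=.
      by rewrite drop_size_cat.
    - by rewrite eqseq_cat// eqxx => /eqP ->; exists t.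
    - rewrite strict_prefixesP size_cat => /andP[_].
      by rewrite ltnNge leq_addr.
  move=> [s sJ ->]; rewrite prefix_prefix; split => //; apply/or3P; apply: Or32.
  by apply/imfsetP; exists s.
rewrite (bigID (fun a => a \in strict_prefixes w))/= [X in _ + X]big1 ?addr0.
  rewrite -big_filter; apply: perm_big; apply: uniq_perm.
  - by rewrite filter_uniq// fset_uniq.
  - exact: strict_prefixes_uniq.
  move=> b; rewrite mem_filter !inE; apply/andP/idP => [[/andP[]]//|bp].
  rewrite bp orbT orbT andbT; split => //.
  move: bp; rewrite strict_prefixesP => /andP[_]; rewrite ltnNge.
  by apply: contraNN => /prefixP[s ->]; rewrite size_cat leq_addr.
move=> b /andP[wb nb]; apply: form_comp_term_incomp => //.
apply: contraNN nb => bw; rewrite strict_prefixesP bw ltnNge.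
apply: contraNN wb => sz; move/prefixP: bw => [s wE].
move: sz; rewrite wE size_cat -[X in (_ <= X)%N]addn0 leq_add2l leqn0 size_eq0.
by move=> /eqP ->; rewrite cats0 prefix_refl.
Qed.

Lemma ker_dstar_closed (F : set_system {fset word}) {FF : ProperFilter F}
    (g : {fset word} -> H) x :
  g @ F --> x -> (forall A, ker_dstar K dot symb (g A)) -> ker_dstar K dot symb x.
Proof.
move=> gx gk u du.
have l : (fun A => dot (g A) (partial u)) @ F --> dot x (partial u).
  by apply: (dot_cvg dnorm) => //; exact: cvg_cst.
rewrite (funext (fun A => gk A u du)) in l.
have l0 : (fun=> 0 : R) @ F --> (0 : R) by exact: cvg_cst.
exact: (@cvg_unique R (@Rhausdorff R) _ _ _ _ l l0).
Qed.

(** The finite sum over strict prefixes of [w] is exact and joins [eta \o Fw w]; the remaining tail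
    is a limit of elements of the closed kernel. Both projection claims then say that this tail is
    orthogonal to exact forms. *)
Lemma form_comp_hodge w om eta Theta (c : word -> R) :
  hodge K dot symb act psi om eta Theta c ->
  [/\ summable_in (form_comp_term K symb act psi c w),
      orth_proj dot (im_partial K symb) (form_comp K symb act psi eta c w)
        (partial (exact_part K psi eta c w)),
      summable_in (fun s => c (w ++ s) *: dpsi s) &
      orth_proj dot (ker_dstar K dot symb) (form_comp K symb act psi eta c w)
        (sum_in (fun s => c (w ++ s) *: dpsi s))].
Proof.
move=> hd; have de := hodge_dom hd.
have sf := @summable_form_comp_term w _ _ (hodge_sum hd).
have tail := form_comp_term_tail sf.
have sg := cvgP _ tail.
have [dx xE] := exact_part_spec c w de.
have SE : sum_in (fun s => c (w ++ s) *: dpsi s) =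
    form_comp K symb act psi eta c w - partial (exact_part K psi eta c w).
  rewrite /sum_in (cvg_lim (@norm_hausdorff _ H) tail) xE /form_comp /sum_in.
  by rewrite opprD addrACA subrr add0r.
have kS : ker_dstar K dot symb (sum_in (fun s => c (w ++ s) *: dpsi s)).
  apply: ker_dstar_closed sg _ => A u du; rewrite /partial_sum dot_suml big1// => i _.
  by rewrite dotZl d_psi_ker ?mulr0.
split => //; split => //.
- by exists (exact_part K psi eta c w).
- by move=> _ [u du <-]; rewrite -SE; exact: kS.
- by move=> z kz; rewrite SE opprB addrCA subrr addr0 dotC; exact: kz.
Qed.

End Pieces.

End BorelAction.

Theorem theorem5p1 (R : realType) (K : set (plane R)) (hK : attractor K)
  (nu : (plane R -> R) -> (plane R -> R) -> {charge set (plane R) -> \bar R})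
  (hnu : forall u v, dom K u -> dom K v -> energy_measure K u v (nu u v))
  (H : completeNormedModType R) (dot : {dot H for idfun})
  (symb : (plane R -> R) -> (plane R -> R) -> H)
  (hH : one_form_space K dot symb nu)
  (act : (plane R -> R) -> H -> H)
  (hact : borel_action K dot symb act nu)
  (nuH : H -> H -> {charge set (plane R) -> \bar R})
  (hnuH : forall om om', form_measure K dot act om om' (nuH om om'))
  (psi : word -> plane R -> R) (hpsi : psi_spec K psi) (w : word) :
  (forall (om : H) (eta : plane R -> R) (Theta : H) (c : word -> R),
     hodge K dot symb act psi om eta Theta c ->
     [/\ summable_in (form_comp_term K symb act psi c w),
         orth_proj dot (im_partial K symb) (form_comp K symb act psi eta c w)
           (partial symb (exact_part K psi eta c w)),
         summable_in (fun v => c (w ++ v) *: d_psi K symb act psi v) &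
         orth_proj dot (ker_dstar K dot symb) (form_comp K symb act psi eta c w)
           (sum_in (fun v => c (w ++ v) *: d_psi K symb act psi v))]) /\
  (forall (om om' : H) (eta eta' : plane R -> R) (Theta Theta' : H)
          (c c' : word -> R),
     hodge K dot symb act psi om eta Theta c ->
     hodge K dot symb act psi om' eta' Theta' c' ->
     forall A : set (plane R), measurable A -> A `<=` K ->
       nuH om om' (Fw w @` A) =
       ((rfac ^- size w)%:E *
        nuH (form_comp K symb act psi eta c w)
            (form_comp K symb act psi eta' c' w) A)%E).
Proof.
split; first exact: (form_comp_hodge hK hnu hH hact hnuH hpsi).
exact: (form_measure_pull hK hnu hH hact hnuH hpsi).
Qed.
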